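(* Let $\mathcal{V}$ be a variety of algebras. The following conditions are equivalent: (1) $\mathcal{V}$ is congruence meet-semidistributive. (2) $\Delta(\alpha,\alpha)=\mathrm{Rect}(\alpha,\alpha)$ for all $\mathbb{A}\in\mathcal{V}$ and $\alpha\in\mathrm{Con}(\mathbb{A})$. (3) For every $n\ge2$: $\Delta(\underbrace{\alpha,\dots,\alpha}_n)=\mathrm{Rect}(\underbrace{\alpha,\dots,\alpha}_n)$ for all $\mathbb{A}\in\mathcal{V}$ and $\alpha\in\mathrm{Con}(\mathbb{A})$. (4) For some fixed $n\ge2$: $\Delta(\underbrace{\alpha,\dots,\alpha}_n)=\mathrm{Rect}(\underbrace{\alpha,\dots,\alpha}_n)$ for all $\mathbb{A}\in\mathcal{V}$ and $\alpha\in\mathrm{Con}(\mathbb{A})$. (5) There exists $n\ge2$ such that the $n$-ary hypercommutator is neutral across $\mathcal{V}$. (6) The binary hypercommutator is neutral across $\mathcal{V}$.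
   Context: $\mathcal{V}$ is congruence meet-semidistributive if for every $\mathbb{A}\in\mathcal{V}$ and $\alpha,\beta,\gamma\in\mathrm{Con}(\mathbb{A})$, $\gamma\wedge\alpha=\gamma\wedge\beta$ implies $\gamma\wedge(\alpha\vee\beta)=\gamma\wedge\alpha$. Identify $n$ with $\{0,\dots,n-1\}$; $2^n$ is the set of functions $f:n\to\{0,1\}$, and for $\gamma\in A^{2^n}$ write $\gamma_f$ for its value at $f$. For $i\in n$, $\epsilon\in\{0,1\}$, $\mathrm{Faces}_i^\epsilon(\gamma)\in A^{2^{n\setminus\{i\}}}$ is $g\mapsto\gamma_{g\cup\{(i,\epsilon)\}}$; for $R\subseteq A^{2^n}$, $\mathrm{Faces}_i(R)=\{\langle\mathrm{Faces}_i^0(\gamma),\mathrm{Faces}_i^1(\gamma)\rangle:\gamma\in R\}$. A binary relation $E$ is quasireflexive if $\langle a,b\rangle\in E$ implies $\langle a,a\rangle,\langle b,b\rangle\in E$. An $n$-dimensional congruence of $\mathbb{A}$ is a subset $R\subseteq A^{2^n}$ compatible with the basic operations of $\mathbb{A}$ such that each $\mathrm{Faces}_i(R)$, $i\in n$, is quasireflexive, symmetric and transitive. $\mathrm{cube}_i(x,y)\in A^{2^n}$ has value $x$ at $f$ if $f_i=0$ and $y$ if $f_i=1$. For $\theta_0,\dots,\theta_{n-1}\in\mathrm{Con}(\mathbb{A})$, $\Delta(\theta_0,\dots,\theta_{n-1})$ is the least $n$-dimensional congruence of $\mathbb{A}$ containing $\bigcup_{i\in n}\{\mathrm{cube}_i(x,y):\langle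 x,y\rangle\in\theta_i\}$. For $i\in n$, $g\in 2^{n\setminus\{i\}}$, the $(i)$-cross-section line of $\gamma$ at $g$ is $\langle\gamma_{g\cup\{(i,0)\}},\gamma_{g\cup\{(i,1)\}}\rangle$. $\mathrm{Rect}(\theta_0,\dots,\theta_{n-1})$ is the set of all $\gamma\in A^{2^n}$ such that for all $i\in n$ every $(i)$-cross-section line of $\gamma$ belongs to $\theta_i$. For $\delta\in\mathrm{Con}(\mathbb{A})$, $R\subseteq A^{2^n}$ has $(\delta,i)$-centrality if there is no $\gamma\in R$ for which exactly $2^{n-1}-1$ of its $2^{n-1}$ $(i)$-cross-section lines belong to $\delta$. The $n$-ary hypercommutator ($n\ge2$) is $[\theta_0,\dots,\theta_{n-1}]_{H}=\bigwedge\{\delta\in\mathrm{Con}(\mathbb{A}):\Delta(\theta_0,\dots,\theta_{n-1})\text{ has }(\delta,n-1)\text{-centrality}\}$. It is neutral across $\mathcal{V}$ if $[\theta_0,\dots,\theta_{n-1}]_H=\bigwedge_{i\in n}\theta_i$ for all $\mathbb{A}\in\mathcal{V}$ and $(\theta_0,\dots,\theta_{n-1})\in\mathrm{Con}(\mathbb{A})^n$. *)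

(* Defs.v *)
From HB Require Import structures.
From mathcomp Require Import all_boot.
From mathcomp Require Import boolp classical_sets.

Set Implicit Arguments.
Unset Strict Implicit.
Unset Printing Implicit Defensive.

Local Open Scope classical_set_scope.

Record signature := Signature {
  op_symbol : Type;
  arity : op_symbol -> nat
}.

(* Finitary algebras; as usual in universal algebra, universes are nonempty. *)
Record algebra (S : signature) := Algebra {
  carrier :> Type;
  carrier_inhabited : inhabited carrier;
  op : forall f : op_symbol S, ('I_(arity f) -> carrier) -> carrier
}.

Inductive term (S : signature) : Type :=
| Var (x : nat)
| App (f : op_symbol S) (ts : 'I_(arity f) -> term S).

Fixpoint eval (S : signature) (A : algebra S) (v : nat -> A) (t : term S) : A :=
  match t with
  | Var x => v x
  | App f ts => op (fun k => eval v (ts k))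
  end.

Definition satisfies (S : signature) (A : algebra S) (e : term S * term S) :=
  forall v : nat -> A, eval v e.1 = eval v e.2.

Definition variety (S : signature) (V : algebra S -> Prop) :=
  exists E : set (term S * term S),
    forall A : algebra S, V A <-> (forall e, E e -> satisfies A e).

Section Relations.
Variables (T : Type) (E : set (T * T)).

Definition reflexive_rel := forall x, E (x, x).
Definition quasireflexive := forall x y, E (x, y) -> E (x, x) /\ E (y, y).
Definition symmetric_rel := forall x y, E (x, y) -> E (y, x).
Definition transitive_rel := forall x y z, E (x, y) -> E (y, z) -> E (x, z).

End Relations.

Section Congruences.
Variables (S : signature) (A : algebra S).

Definition congruence (theta : set (A * A)) :=
  [/\ reflexive_rel theta, symmetric_rel theta, transitive_rel theta &
      forall (f : op_symbol S) (a b : 'I_(arity f) -> A),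
        (forall k, theta (a k, b k)) -> theta (op a, op b)].

(* The meet of two congruences is their intersection `&`. *)
Definition cjoin (alpha beta : set (A * A)) : set (A * A) :=
  smallest congruence (alpha `|` beta).

End Congruences.

Definition congruence_meet_semidistributive (S : signature)
    (V : algebra S -> Prop) :=
  forall A : algebra S, V A -> forall alpha beta gamma : set (A * A),
    congruence alpha -> congruence beta -> congruence gamma ->
    gamma `&` alpha = gamma `&` beta ->
    gamma `&` cjoin alpha beta = gamma `&` alpha.

(* [cube A I] is A^(2^I); the paper's 2^n is [{ffun 'I_n -> bool}], with
   [false] for 0 and [true] for 1, and n \ {i} is [others i]. *)
Definition cube (A : Type) (I : finType) := {ffun I -> bool} -> A.

Definition others (n : nat) (i : 'I_n) : finType := {j : 'I_n | j != i}.

(* g \cup {(i, eps)} *)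
Definition extend (n : nat) (i : 'I_n) (g : {ffun others i -> bool})
    (eps : bool) : {ffun 'I_n -> bool} :=
  [ffun j => if insub j is Some k then g k else eps].

Definition face (A : Type) (n : nat) (i : 'I_n) (eps : bool)
    (gamma : cube A 'I_n) : cube A (others i) :=
  fun g => gamma (extend g eps).
Arguments face {A n} i eps gamma g.

Definition faces (A : Type) (n : nat) (i : 'I_n) (R : set (cube A 'I_n)) :
    set (cube A (others i) * cube A (others i)) :=
  [set (face i false gamma, face i true gamma) | gamma in R].
Arguments faces {A n} i R _.

Section Cubes.
Variables (A : Type) (n : nat).
Implicit Types (i : 'I_n) (gamma : cube A 'I_n) (R : set (cube A 'I_n)).

(* The (i)-cross-section line of gamma at g; i is read off the type of g. *)
Definition line i gamma (g : {ffun others i -> bool}) : A * A :=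
  (gamma (extend g false), gamma (extend g true)).

Definition cube_pair i (x y : A) : cube A 'I_n :=
  fun f => if f i then y else x.

Definition rect (theta : 'I_n -> set (A * A)) : set (cube A 'I_n) :=
  [set gamma | forall i (g : {ffun others i -> bool}), theta i (line gamma g)].

Definition centrality (delta : set (A * A)) i R :=
  ~ exists2 gamma, R gamma &
      #|[pred g : {ffun others i -> bool} | `[< delta (line gamma g) >]]|
        = 2 ^ (n - 1) - 1.

End Cubes.

Section HigherDimensionalCongruences.
Variables (S : signature) (A : algebra S) (n : nat).

Definition compatible (R : set (cube A 'I_n)) :=
  forall (f : op_symbol S) (gammas : 'I_(arity f) -> cube A 'I_n),
    (forall k, R (gammas k)) -> R (fun v => op (fun k => gammas k v)).

Definition ncongruence (R : set (cube A 'I_n)) :=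
  compatible R /\
  forall i, [/\ quasireflexive (faces i R), symmetric_rel (faces i R) &
                transitive_rel (faces i R)].

Definition Delta (theta : 'I_n -> set (A * A)) : set (cube A 'I_n) :=
  smallest ncongruence
    (\bigcup_i [set cube_pair i p.1 p.2 | p in theta i]).

(* [l.+1 = n] selects the last coordinate n - 1 (it exists as soon as n > 0).
   For n > 0, delta = A * A always qualifies, so the family is nonempty. *)
Definition hypercommutator (theta : 'I_n -> set (A * A)) : set (A * A) :=
  \bigcap_(delta in [set delta | congruence delta /\
    forall l : 'I_n, l.+1 = n -> centrality delta l (Delta theta)]) delta.

End HigherDimensionalCongruences.

Definition Delta_eq_rect (S : signature) (V : algebra S -> Prop) (n : nat) :=
  forall A : algebra S, V A -> forall alpha : set (A * A), congruence alpha ->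
    Delta (fun _ : 'I_n => alpha) = rect (fun _ : 'I_n => alpha).

Definition hypercommutator_neutral (S : signature) (V : algebra S -> Prop)
    (n : nat) :=
  forall A : algebra S, V A -> forall theta : 'I_n -> set (A * A),
    (forall i, congruence (theta i)) ->
    hypercommutator theta = \bigcap_i theta i.

(* Main.v *)
Require Import Defs.
From mathcomp Require Import all_boot.
From mathcomp Require Import boolp classical_sets.

(* From meet-semidistributivity to Delta = Rect: the algebra of alpha-related
   pairs carries the kernel eta of the first projection, the two-dimensional
   congruence T, and kappa = {((a,b),(c,d)) : the square with rows (a,b), (a,d)
   is in T}. Since eta meets T and kappa in the same congruence, eta also meets
   T \/ kappa there, and this forces every square with three equal corners into
   T. Higher dimensions follow by viewing an (n+1)-cube as an n-cube of pairs.

   From Delta = Rect to neutrality: a cube with a single exceptional corner y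
   and x elsewhere witnesses (x, y) in any delta with centrality.

   From neutrality to meet-semidistributivity: neutrality makes every square
   x x / x y with (x, y) in theta a member of every two-dimensional congruence
   that contains the cubes of theta. On the free algebra on two generators this
   yields a Taylor term: if every idempotent term violated the Taylor condition
   at some coordinate, these coordinates would act as projections and Delta
   would look as it does on a set. Now let gamma /\ alpha = gamma /\ beta = delta
   and theta = gamma /\ (alpha \/ beta). The term condition for alpha and beta
   makes the matrices of theta central modulo delta. With a Taylor term, three
   corners of such a matrix determine the fourth modulo delta, and this property
   survives the composition of squares in either direction, hence holds for
   Delta(theta, theta); applied to x x / x y it gives theta = delta. *)

Set Implicit Arguments.
Unset Strict Implicit.
Unset Printing Implicit Defensive.

Local Open Scope classical_set_scope.

(** * Algebras, pairs and quotients *)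

Section Algebras.
Variable S : signature.

Lemma smallest_congruence (A : algebra S) (G : set (A * A)) :
  congruence (smallest (@congruence S A) G).
Proof.
split=> [x M [[r _ _ _] _]|x y h M [cM sM]|x y z h1 h2 M [cM sM]|f a b h M [cM sM]].
- exact: r.
- by have [_ s _ _] := cM; apply: s; apply: h.
- by have [_ _ t _] := cM; apply: (t _ y); [apply: h1|apply: h2].
- by have [_ _ _ c] := cM; apply: c => k; apply: h.
Qed.

Lemma congruenceI (A : algebra S) (alpha beta : set (A * A)) :
  congruence alpha -> congruence beta -> congruence (alpha `&` beta).
Proof.
move=> [r s t c] [r' s' t' c']; split.
- by split; [exact: r|exact: r'].
- by move=> x y [h h']; split; [exact: s|exact: s'].
- by move=> x y z [h h'] [k k']; split; [exact: t k|exact: t' k'].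
- by move=> f a b h; split; [apply: c|apply: c'] => k; have [] := h k.
Qed.

Lemma congruence_eval (A : algebra S) (theta : set (A * A)) t (v w : nat -> A) :
  congruence theta -> (forall k, theta (v k, w k)) ->
  theta (eval v t, eval w t).
Proof.
by move=> [_ _ _ c] h; elim: t => [x|f ts IH] /=; [exact: h|exact: c].
Qed.

Lemma eval_hom (A B : algebra S) (phi : A -> B) t (v : nat -> A) :
  (forall f (a : 'I_(arity f) -> A), phi (op a) = op (phi \o a)) ->
  phi (eval v t) = eval (phi \o v) t.
Proof.
move=> hphi; elim: t => [x //|f ts IH] /=; rewrite hphi; congr op.
by apply/funext => k /=; rewrite IH.
Qed.

Fixpoint var_bound (t : term S) : nat :=
  match t with
  | Var x => x.+1
  | App f ts => \max_k var_bound (ts k)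
  end.

Lemma eval_var_bound (A : algebra S) (v w : nat -> A) t :
  (forall k, k < var_bound t -> v k = w k) -> eval v t = eval w t.
Proof.
elim: t => [x h|f ts IH h] /=; first exact: h.
congr op; apply/funext => k; apply: IH => j hj; apply: h => /=.
by apply: leq_trans hj _; exact: (leq_bigmax k).
Qed.

Lemma sig_ext (T : Type) (P : T -> Prop) (u v : {x | P x}) :
  sval u = sval v -> u = v.
Proof. exact: eq_sig_hprop (fun _ => @Prop_irrelevance _) u v. Qed.

Section PairAlgebra.
Variables (A : algebra S) (theta : set (A * A)) (htheta : congruence theta).

Lemma pair_inhabited : inhabited {p : A * A | theta p}.
Proof.
have [x] := carrier_inhabited A; have [r _ _ _] := htheta.
by exists; exists (x, x); exact: r.
Qed.

Lemma pair_op_subproof f (a : 'I_(arity f) -> {p : A * A | theta p}) :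
  theta (op (fun k => (sval (a k)).1), op (fun k => (sval (a k)).2)).
Proof.
have [_ _ _ c] := htheta; apply: c => k; rewrite -surjective_pairing.
exact: svalP.
Qed.

Definition pair_algebra : algebra S :=
  @Algebra S {p : A * A | theta p} pair_inhabited
    (fun f a => exist _ _ (pair_op_subproof a)).

Lemma pair_eval (v : nat -> pair_algebra) t :
  sval (eval v t) =
  (eval (fun k => (sval (v k)).1) t, eval (fun k => (sval (v k)).2) t).
Proof.
elim: t => [x|f ts IH] /=; first by rewrite -surjective_pairing.
by congr pair; congr op; apply/funext => k; rewrite IH.
Qed.

Lemma pair_algebra_variety V : variety V -> V A -> V pair_algebra.
Proof.
move=> [E hE] /hE hA; apply/hE => e /hA eE v.
by apply: sig_ext; rewrite !pair_eval !eE.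
Qed.

End PairAlgebra.

Section Quotient.
Variables (A : algebra S) (theta : set (A * A)) (htheta : congruence theta).

(** Classes are encoded as sets, so that equality in the quotient is equality of classes. Operations
    go through chosen representatives; [quotient_op] shows that the choice does not matter for a
    congruence. *)
Definition quotient_carrier :=
  {c : set A | exists a, c = [set b | theta (a, b)]}.

Definition class_of (a : A) : quotient_carrier :=
  exist _ [set b | theta (a, b)] (ex_intro _ a erefl).

Definition class_repr (u : quotient_carrier) : A := sval (cid (svalP u)).

Lemma class_reprK u : class_of (class_repr u) = u.
Proof. by apply: sig_ext; rewrite /= /class_repr; case: (cid _). Qed.

Lemma eq_class_of a b : class_of a = class_of b <-> theta (a, b).
Proof.
have [r s t _] := htheta; split=> [[] e|h].
  by rewrite -[theta (a, b)]/([set c | theta (a, c)] b) e; exact: r.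
apply: sig_ext; apply/seteqP; split=> c /= hc; first exact: t (s _ _ h) hc.
exact: t h hc.
Qed.

Definition quotient : algebra S :=
  @Algebra S quotient_carrier
    (let: inhabits a := carrier_inhabited A in inhabits (class_of a))
    (fun f u => class_of (op (fun k => class_repr (u k)))).

Lemma quotient_op f (a : 'I_(arity f) -> A) :
  @op S quotient f (fun k => class_of (a k)) = class_of (op a).
Proof.
have [_ _ _ c] := htheta; apply/eq_class_of; apply: c => k.
by apply/eq_class_of; rewrite class_reprK.
Qed.

End Quotient.
End Algebras.

(** * Squares *)

(* [Q a b c d] is about the square with rows (a, b) and (c, d). *)
Definition square_rel (A : Type) := A -> A -> A -> A -> Prop.

Definition hcomp (A : Type) (Q : square_rel A) : square_rel A :=
  fun a b c d => exists r r', Q a r c r' /\ Q r b r' d.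

Definition transpose (A : Type) (Q : square_rel A) : square_rel A :=
  fun a b c d => Q a c b d.

Section Squares.
Variables (S : signature) (A : algebra S).
Implicit Types (Q T : square_rel A) (G theta delta : set (A * A)).

Definition sq_compatible Q := forall f (a b c d : 'I_(arity f) -> A),
  (forall k, Q (a k) (b k) (c k) (d k)) -> Q (op a) (op b) (op c) (op d).

Lemma sq_eval Q t (a b c d : nat -> A) : sq_compatible Q ->
  (forall k, Q (a k) (b k) (c k) (d k)) ->
  Q (eval a t) (eval b t) (eval c t) (eval d t).
Proof. by move=> cQ h; elim: t => [x|f ts IH] /=; [exact: h|exact: cQ]. Qed.

Lemma sq_compatible_hcomp Q : sq_compatible Q -> sq_compatible (hcomp Q).
Proof.
move=> cQ f a b c d /choice[r /choice[r' h]].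
by exists (op r), (op r'); split; apply: cQ => k; have [] := h k.
Qed.

Lemma sq_compatible_transpose Q :
  sq_compatible Q -> sq_compatible (transpose Q).
Proof. by move=> cQ f a b c d; apply: cQ. Qed.

Lemma sq_compatible_union (Q : nat -> square_rel A) :
  (forall k, sq_compatible (Q k)) ->
  (forall k a b c d, Q k a b c d -> Q k.+1 a b c d) ->
  sq_compatible (fun a b c d => exists k, Q k a b c d).
Proof.
move=> cQ mQ f a b c d /choice[m h].
have mono k j x y z t : k <= j -> Q k x y z t -> Q j x y z t.
  by move=> /subnK <-; elim: (j - k) => [//|i IH] /IH; apply: mQ.
(* Arities are finite, so a single stage contains all the argument squares. *)
exists (\max_k m k); apply: cQ => k.
by apply: mono (h k); apply: (leq_bigmax k).
Qed.

(** A two-dimensional congruence without transitivity. [G] bounds from below the pairs whose cubes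
    occur, [theta] bounds the edges from above. The two differ only for the free algebra, where the
    single nontrivial pair of generators is placed in [G]. *)
Record sq_pre G theta Q : Prop := SqPre {
  sq_compat : sq_compatible Q;
  sq_gen : forall x y, G (x, y) -> Q x x y y /\ Q x y x y;
  sq_hsym : forall a b c d, Q a b c d -> Q b a d c;
  sq_vsym : forall a b c d, Q a b c d -> Q c d a b;
  sq_hdeg : forall a b c d, Q a b c d -> Q a a c c;
  sq_vdeg : forall a b c d, Q a b c d -> Q a b a b;
  sq_rect : forall a b c d, Q a b c d ->
    [/\ theta (a, b), theta (a, c) & theta (a, d)]
}.

Record sq_congruence theta Q : Prop := SqCongruence {
  sq_congruence_pre : sq_pre theta theta Q;
  sq_htrans : forall a b c d e f, Q a b c d -> Q b e d f -> Q a e c f;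
  sq_vtrans : forall a b c d e f, Q a b c d -> Q c d e f -> Q a b e f
}.

Lemma sq_pre_transpose G theta Q :
  sq_pre G theta Q -> sq_pre G theta (transpose Q).
Proof.
move=> [c g hs vs hd vd r]; split => //.
- exact: sq_compatible_transpose.
- by move=> x y /g[].
- by move=> a b' c' d; apply: vs.
- by move=> a b' c' d; apply: hs.
- by move=> a b' c' d; apply: vd.
- by move=> a b' c' d; apply: hd.
- by move=> a b' c' d /r[].
Qed.

Lemma sub_hcomp G theta Q a b c d :
  sq_pre G theta Q -> Q a b c d -> hcomp Q a b c d.
Proof. by move=> [_ _ hs vs hd vd _] h; exists b, d; split=> //; apply: hd; apply: hs h. Qed.

Lemma sq_pre_hcomp G theta Q :
  congruence theta -> sq_pre G theta Q -> sq_pre G theta (hcomp Q).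
Proof.
move=> [_ _ tt _] pQ; have sub := sub_hcomp pQ.
have [c g hs vs hd vd r] := pQ; split.
- exact: sq_compatible_hcomp.
- by move=> x y /g[g1 g2]; split; apply: sub.
- by move=> a b c' d [p [q [h1 h2]]]; exists p, q; split; apply: hs.
- by move=> a b c' d [p [q [h1 h2]]]; exists q, p; split; apply: vs.
- by move=> a b c' d [p [q [h1 h2]]]; apply: sub; apply: hd h1.
- by move=> a b c' d [p [q [h1 h2]]]; exists p, p; split; [apply: vd h1|apply: vd h2].
- move=> a b c' d [p [q [/r[ap ac aq] /r[pb pq' pd]]]].
  by split=> //; [apply: tt ap pb|apply: tt ap pd].
Qed.

(** Alternating horizontal and vertical composition gives an increasing chain whose union is
    transitive in both directions. The invariant [P] is a property of a whole relation, because some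
    invariants compare two squares; it is carried along the stages, and each square of the union
    lies in some stage. *)
Lemma sq_closure G theta Q (P : square_rel A -> Prop) :
  congruence theta -> G `<=` theta ->
  (forall rho, congruence rho -> G `<=` rho -> theta `<=` rho) ->
  (forall a, G (a, a)) -> sq_pre G theta Q -> P Q ->
  (forall Q', sq_pre G theta Q' -> P Q' -> P (hcomp Q')) ->
  (forall Q', P Q' -> P (transpose Q')) ->
  exists2 T, sq_congruence theta T & forall a b c d, T a b c d ->
    exists2 Q', sq_pre G theta Q' /\ P Q' & Q' a b c d.
Proof.
move=> ct sG leastG rG pQ PQ Ph Pt.
pose step (R : square_rel A) := transpose (hcomp (transpose (hcomp R))).
pose Qk k := iter k step Q.
have hQk k : sq_pre G theta (Qk k) /\ P (Qk k).
  elim: k => [//|k [IH1 IH2]]; split=> /=.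
    by apply/sq_pre_transpose/sq_pre_hcomp/sq_pre_transpose/sq_pre_hcomp.
  apply/Pt/Ph; last exact/Pt/Ph.
  by apply/sq_pre_transpose/sq_pre_hcomp.
have preh R : sq_pre G theta R -> sq_pre G theta (transpose (hcomp R)).
  by move=> ?; apply/sq_pre_transpose/sq_pre_hcomp.
have sub1 k a b c d : Qk k a b c d -> Qk k.+1 a b c d.
  move=> h /=; apply: (@sub_hcomp G theta); first by apply/preh; case: (hQk k).
  by apply: (@sub_hcomp G theta); first by case: (hQk k).
have mono k j x y z t : k <= j -> Qk k x y z t -> Qk j x y z t.
  by move=> /subnK <-; elim: (j - k) => [//|i IH] /IH; apply: sub1.
have htr k a b c d e f : Qk k a b c d -> Qk k b e d f -> Qk k.+1 a e c f.
  move=> h1 h2 /=; apply: (@sub_hcomp G theta); first by apply/preh; case: (hQk k).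
  by exists b, d.
have vtr k a b c d e f : Qk k a b c d -> Qk k c d e f -> Qk k.+1 a b e f.
  move=> h1 h2 /=; exists c, d; split.
    by apply: (@sub_hcomp G theta) h1; case: (hQk k).
  by apply: (@sub_hcomp G theta) h2; case: (hQk k).
pose T a b c d := exists k, Qk k a b c d.
have cT : sq_compatible T.
  by apply: sq_compatible_union => // k; case: (hQk k) => -[].
have two a b c d a' b' c' d' : T a b c d -> T a' b' c' d' ->
    exists2 k, Qk k a b c d & Qk k a' b' c' d'.
  move=> [k1 h1] [k2 h2]; exists (maxn k1 k2).
    by apply: mono h1; exact: leq_maxl.
  by apply: mono h2; exact: leq_maxr.
have hT a b c d e f : T a b c d -> T b e d f -> T a e c f.
  by move=> h1 h2; have [k h3 h4] := two _ _ _ _ _ _ _ _ h1 h2; exists k.+1; apply: htr h3 h4.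
have vT a b c d e f : T a b c d -> T c d e f -> T a b e f.
  by move=> h1 h2; have [k h3 h4] := two _ _ _ _ _ _ _ _ h1 h2; exists k.+1; apply: vtr h3 h4.
have hs a b c d : T a b c d -> T b a d c.
  by move=> [k h]; exists k; have [[_ _ x _ _ _ _] _] := hQk k; apply: x.
have vs a b c d : T a b c d -> T c d a b.
  by move=> [k h]; exists k; have [[_ _ _ x _ _ _] _] := hQk k; apply: x.
have gT x y : G (x, y) -> T x x y y /\ T x y x y.
  by have [_ g _ _ _ _ _] := pQ => /g[g1 g2]; split; exists 0.
exists T; last by move=> a b c d [k h]; exists (Qk k).
split=> //; split=> //.
(* The pairs whose two cubes lie in [T] form a congruence containing [G], hence containing
   [theta]. *)
- pose rho : set (A * A) := [set p | T p.1 p.1 p.2 p.2 /\ T p.1 p.2 p.1 p.2].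
  move=> x y hxy; apply: (leastG rho _ _ (x, y) hxy); last by move=> [u v] /gT.
  split=> /=.
  + by move=> u; apply: gT.
  + by move=> u v /= [h1 h2]; split; [exact: vs|exact: hs].
  + by move=> u v w [/= h1 h2] [/= h3 h4]; split; [exact: vT h1 h3|exact: hT h2 h4].
  + by move=> f u v h; split; apply: cT => k; have [] := h k.
- by move=> a b c d [k h]; exists k; have [[_ _ _ _ x _ _] _] := hQk k; apply: x h.
- by move=> a b c d [k h]; exists k; have [[_ _ _ _ _ x _] _] := hQk k; apply: x h.
- by move=> a b c d [k h]; have [[_ _ _ _ _ _ x] _] := hQk k; apply: x h.
Qed.

End Squares.

(** * Faces of cubes *)

Section CubeFaces.
Variable n : nat.
Implicit Types (i j : 'I_n) (f : {ffun 'I_n -> bool}).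

(** Changing one coordinate of a full vertex replaces [extend], whose argument has a type depending
    on [i]. *)
Definition upd i (b : bool) f : {ffun 'I_n -> bool} :=
  [ffun j => if j == i then b else f j].

Definition restrict i f : {ffun others i -> bool} := [ffun k => f (val k)].

Lemma upd_same i b f : upd i b f i = b.
Proof. by rewrite ffunE eqxx. Qed.

Lemma upd_upd i b c f : upd i b (upd i c f) = upd i b f.
Proof. by apply/ffunP => j; rewrite !ffunE; case: eqP. Qed.

Lemma upd_id i f : upd i (f i) f = f.
Proof. by apply/ffunP => j; rewrite !ffunE; case: eqP => [->|]. Qed.

Lemma updC i j b c f :
  i != j -> upd i b (upd j c f) = upd j c (upd i b f).
Proof.
move=> ij; apply/ffunP => k; rewrite !ffunE.
by case: eqP => [->|//]; rewrite (negbTE ij).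
Qed.

Lemma extendE i (g : {ffun others i -> bool}) b j (ji : j != i) :
  extend g b j = g (exist _ j ji).
Proof. by rewrite ffunE insubT. Qed.

Lemma extend_at i (g : {ffun others i -> bool}) b : extend g b i = b.
Proof. by rewrite ffunE insubF ?eqxx. Qed.

Lemma extend_restrict i f b : extend (restrict i f) b = upd i b f.
Proof.
apply/ffunP => j; have [->|ji] := eqVneq j i; first by rewrite extend_at upd_same.
by rewrite extendE !ffunE /= (negbTE ji).
Qed.

Lemma upd_extend i b (g : {ffun others i -> bool}) c :
  upd i b (extend g c) = extend g b.
Proof.
apply/ffunP => j; rewrite [LHS]ffunE; have [->|ji] := eqVneq j i.
  by rewrite extend_at.
by rewrite !extendE.
Qed.

Variable A : Type.
Implicit Types (gamma : cube A 'I_n) (R : set (cube A 'I_n)).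

Lemma face_inj i gamma gamma' :
  face i false gamma = face i false gamma' ->
  face i true gamma = face i true gamma' -> gamma = gamma'.
Proof.
move=> h0 h1; apply/funext => f; rewrite -(upd_id i f) -extend_restrict.
case: (f i); first exact: (congr1 (@^~ (restrict i f)) h1).
exact: (congr1 (@^~ (restrict i f)) h0).
Qed.

Definition degenerate i b gamma : cube A 'I_n := fun f => gamma (upd i b f).
Definition flip i gamma : cube A 'I_n := fun f => gamma (upd i (~~ f i) f).
Definition glue i gamma gamma' : cube A 'I_n :=
  fun f => if f i then gamma' f else gamma f.

Lemma face_degenerate i b c gamma :
  face i b (degenerate i c gamma) = face i c gamma.
Proof. by apply/funext => g; rewrite /face /degenerate upd_extend. Qed.

Lemma face_flip i b gamma : face i b (flip i gamma) = face i (~~ b) gamma.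
Proof. by apply/funext => g; rewrite /face /flip extend_at upd_extend. Qed.

Lemma face_glue i b gamma gamma' :
  face i b (glue i gamma gamma') = if b then face i b gamma' else face i b gamma.
Proof. by case: b; apply/funext => g; rewrite /face /glue extend_at. Qed.

Definition degenerate_closed R i := forall gamma b, R gamma -> R (degenerate i b gamma).
Definition flip_closed R i := forall gamma, R gamma -> R (flip i gamma).
Definition glue_closed R i := forall gamma gamma', R gamma -> R gamma' ->
  face i true gamma = face i false gamma' -> R (glue i gamma gamma').

(** By [face_inj] a cube is determined by its two opposite faces, so the cubes provided by
    quasireflexivity, symmetry and transitivity can be named: they are [degenerate], [flip] and
    [glue]. *)
Lemma faces_closed i R :
  [/\ quasireflexive (faces i R), symmetric_rel (faces i R) &
      transitive_rel (faces i R)] <->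
  [/\ degenerate_closed R i, flip_closed R i & glue_closed R i].
Proof.
split=> [[q s t]|[q s t]]; split.
- move=> gamma b hR.
  have [[g hg [e0 e1]] [g' hg' [e0' e1']]] :
      faces i R (face i false gamma, face i false gamma) /\
      faces i R (face i true gamma, face i true gamma).
    by apply: q; exists gamma.
  case: b; [suff <- : g' = degenerate i true gamma by []|
            suff <- : g = degenerate i false gamma by []];
  by apply: (@face_inj i); rewrite face_degenerate.
- move=> gamma hR; have [|g hg [e0 e1]] := s (face i false gamma) (face i true gamma).
    by exists gamma.
  suff <- : g = flip i gamma by [].
  by apply: (@face_inj i); rewrite face_flip.
- move=> gamma gamma' hR hR' e.
  have [| |g hg [e0 e1]] :=
      t (face i false gamma) (face i true gamma) (face i true gamma').
  + by exists gamma.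
  + by exists gamma' => //; rewrite e.
  suff <- : g = glue i gamma gamma' by [].
  by apply: (@face_inj i); rewrite face_glue.
- move=> u v [gamma hR [<- <-]]; split.
    by exists (degenerate i false gamma); rewrite ?face_degenerate//; apply: q.
  by exists (degenerate i true gamma); rewrite ?face_degenerate//; apply: q.
- move=> u v [gamma hR [<- <-]].
  by exists (flip i gamma); rewrite ?face_flip//; apply: s.
- move=> u v w [gamma hR [<- <-]] [gamma' hR' [e <-]].
  by exists (glue i gamma gamma'); rewrite ?face_glue//; apply: t.
Qed.

Lemma face_eqP i gamma gamma' :
  face i true gamma = face i false gamma' <->
  (forall f, gamma (upd i true f) = gamma' (upd i false f)).
Proof.
split=> [e f|e]; first by rewrite -!extend_restrict; exact: (congr1 (@^~ (restrict i f)) e).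
by apply/funext => g; rewrite /face -(upd_extend true g false) e upd_extend.
Qed.

Lemma rectP (theta : 'I_n -> set (A * A)) gamma :
  rect theta gamma <->
  (forall i f, theta i (gamma (upd i false f), gamma (upd i true f))).
Proof.
split=> [h i f|h i g]; first by rewrite -!extend_restrict; exact: h.
by rewrite /line -(upd_extend false g false) -(upd_extend true g false); exact: h.
Qed.

End CubeFaces.

(** * Rectangles form a higher-dimensional congruence *)

Section RectCongruence.
Variables (S : signature) (A : algebra S) (n : nat).
Variables (theta : 'I_n -> set (A * A)).
Hypothesis htheta : forall i, congruence (theta i).

Lemma ncongruence_rect : ncongruence (rect theta).
Proof.
split=> [f gammas h i g|i].
  by have [_ _ _ c] := htheta i; apply: c => k; exact: h.
have hr (gamma : cube A 'I_n) j b : rect theta gamma -> forall f,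
    theta j (gamma (upd j b f), gamma (upd j (~~ b) f)).
  move=> /rectP h f; have [_ s _ _] := htheta j.
  by case: b; [apply: s|]; exact: h.
apply/faces_closed; split.
- move=> gamma b h; apply/rectP => j f; rewrite /degenerate.
  have [->|ij] := eqVneq i j; first by rewrite !upd_upd; have [r _ _ _] := htheta j.
  by rewrite !(updC _ _ _ ij); exact: (hr _ _ false).
- move=> gamma h; apply/rectP => j f; rewrite /flip.
  have [->|ij] := eqVneq i j; first by rewrite !upd_same !upd_upd; exact: (hr _ _ true).
  rewrite !(updC _ _ _ ij) ![upd j _ f i]ffunE (negbTE ij).
  exact: (hr _ _ false).
- move=> gamma gamma' h h' /face_eqP e; apply/rectP => j f; rewrite /glue.
  have [<-|ij] := eqVneq i j.
    rewrite !upd_same; have [_ _ t _] := htheta i.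
    by apply: t (hr _ _ false h f) _; rewrite /= e; exact: (hr _ _ false).
  rewrite ![upd j _ f i]ffunE (negbTE ij).
  by case: (f i); exact: (hr _ _ false).
Qed.

Lemma cube_pair_rect i x y : theta i (x, y) -> rect theta (cube_pair i x y).
Proof.
move=> h; apply/rectP => j f; rewrite /cube_pair.
have [<-|ij] := eqVneq i j; first by rewrite !upd_same.
by rewrite !ffunE (negbTE ij); have [r _ _ _] := htheta j; exact: r.
Qed.

Lemma Delta_sub R : ncongruence R ->
  (forall i x y, theta i (x, y) -> R (cube_pair i x y)) -> Delta theta `<=` R.
Proof.
move=> hR hc; apply: smallest_sub => // gamma [i _ [[x y] h <-]].
exact: hc.
Qed.

Lemma Delta_sub_rect : Delta theta `<=` rect theta.
Proof. by apply: Delta_sub ncongruence_rect _ => i x y; exact: cube_pair_rect. Qed.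

End RectCongruence.

(** * Centrality *)

Lemma card_vertices n (i : 'I_n) : #|{ffun others i -> bool}| = 2 ^ (n - 1).
Proof.
rewrite card_ffun card_bool card_sig; congr (_ ^ _).
have := cardC1 i; rewrite card_ord -subn1 => <-.
by apply: eq_card.
Qed.

(** There are 2^(n-1) lines in direction [i], so a cube violating centrality has exactly one line
    [g0] outside [delta]. *)
Lemma centralityI (A : Type) n (i : 'I_n) (delta : set (A * A)) R :
  (forall gamma (g0 : {ffun others i -> bool}), R gamma ->
    (forall g, g != g0 -> delta (line gamma g)) -> delta (line gamma g0)) ->
  centrality delta i R.
Proof.
move=> h [gamma hR]; set P := [pred g | _] => hP.
have cP : #|[predC P]| = 1.
  have := cardC P; rewrite hP card_vertices => /eqP.
  by rewrite -{2}(@subnK 1 (2 ^ (n - 1))) ?expn_gt0// eqn_add2l => /eqP.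
have [g0 hg0] := mem_card1 cP.
have /negP : ~~ `[< delta (line gamma g0) >] by have := hg0 g0; rewrite !inE eqxx.
case; apply/asboolP; apply: h => // g gg0.
by have := hg0 g; rewrite !inE (negbTE gg0) => /negbFE/asboolP.
Qed.

Lemma Delta_neutral (S : signature) (V : algebra S -> Prop) n :
  2 <= n -> Delta_eq_rect V n -> hypercommutator_neutral V n.
Proof.
move=> n2 hD A VA theta htheta.
have hmeet : congruence (\bigcap_i theta i).
  split.
  - by move=> x i _; have [r _ _ _] := htheta i.
  - by move=> x y h i hi; have [_ s _ _] := htheta i; apply: s; exact: h.
  - by move=> x y z h h' i hi; have [_ _ t _] := htheta i; apply: t (h i hi) (h' i hi).
  - by move=> f a b h i hi; have [_ _ _ c] := htheta i; apply: c => k; exact: h.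
apply/seteqP; split=> [p|[x y] hxy delta [cdelta hcentral]].
  (* The meet is itself one of the central congruences over which the hypercommutator is
     intersected. *)
  apply; split=> // l _; apply: centralityI => gamma g0 /(Delta_sub_rect htheta) hrect hg0.
  have [j jl] : exists j : 'I_n, j != l.
    have : 0 < #|predC1 l| by rewrite cardC1 card_ord -ltnS prednK // (leq_trans _ n2).
    by case/card_gt0P => j; exists j.
  move=> i _.
  have [->|il] := eqVneq i l; first exact: hrect.
  (* [g1] is the neighbour of [g0] in direction [i]. The ends of the two lines are joined by edges
     in [theta i], so [theta i] passes from the line at [g1] to the line at [g0]. *)
  pose g1 := [ffun k => if k == exist _ i il then ~~ g0 k else g0 k].
  have g10 : g1 != g0.
    apply/eqP => /ffunP/(_ (exist _ i il)); rewrite ffunE eqxx.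
    by case: (g0 _).
  have hg1 := hg0 _ g10 i I; have [_ s t _] := htheta i.
  have ee b : extend g1 b = upd i (~~ extend g0 b i) (extend g0 b).
    apply/ffunP => k; rewrite [RHS]ffunE; have [->|kl] := eqVneq k l.
      by rewrite !extend_at eq_sym (negbTE il).
    rewrite !extendE ffunE -val_eqE /=; case: eqP => // ki.
    by congr (~~ (g0 _)); apply: val_inj.
  have side b : theta i (gamma (extend g0 b), gamma (extend g1 b)).
    have := (rectP _ _).1 hrect i (extend g0 b); rewrite ee.
    have := upd_id i (extend g0 b); case: (extend g0 b i) => /= -> //.
    by apply: s.
  apply: (t _ _ _ (side false)); apply: (t _ _ _ hg1); apply: s; exact: side.
case: n => // n in n2 theta htheta hmeet hxy hD hcentral *.
have [//|ndxy] := pselect (delta (x, y)).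
exfalso; apply: (hcentral (@ord_max n)) => //.
pose gamma : cube A 'I_n.+1 := fun f => if [forall k, f k] then y else x.
exists gamma.
  (* Delta = Rect is available for equal congruences only; it is applied to the meet, and [Delta] is
     monotone. *)
  have : Delta (fun _ : 'I_n.+1 => \bigcap_i theta i) gamma.
    rewrite hD//; apply/rectP => i f; rewrite /gamma.
    have -> : [forall k, upd i false f k] = false.
      by apply/negbTE/forallPn; exists i; rewrite upd_same.
    have [r _ _ _] := hmeet.
    by case: ifP => _; [exact: hxy|exact: r].
  move=> h M [cM sM]; apply: h; split=> // g [i _ [p hp <-]].
  by apply: sM; exists i => //; exists p => //; exact: hp.
(* The only line meeting the exceptional corner is the one at the all-true vertex; every other line
   is constant [x]. *)
rewrite -(card_vertices ord_max) subn1 -(cardC1 ([ffun=> true] : {ffun others ord_max -> bool})).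
apply: eq_card => g; rewrite !inE; have [->|gt] := eqVneq g [ffun=> true].
  apply/asboolPn; rewrite /line /gamma ifF; last first.
    by apply/negbTE/forallPn; exists ord_max; rewrite extend_at.
  rewrite ifT//; apply/forallP => k.
  have [->|kl] := eqVneq k ord_max; first by rewrite extend_at.
  by rewrite extendE ffunE.
apply/asboolP; rewrite /line /gamma.
have e b : [forall k, extend g b k] = false.
  apply/negbTE; apply: contra gt => /forallP h; apply/eqP/ffunP => -[k kl].
  by have := h k; rewrite extendE ffunE.
by rewrite !e; have [r _ _ _] := cdelta.
Qed.

(** * Squares with three equal corners and neutrality *)

Section CornerCongruence.
Variables (S : signature) (A : algebra S) (theta : set (A * A)).
Variable T : square_rel A.
Hypotheses (htheta : congruence theta) (hT : sq_congruence theta T).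

Definition corner : set (A * A) := [set p | T p.1 p.1 p.1 p.2].

Lemma sq_rows x y : theta (x, y) -> T x x y y.
Proof. by have [[_ g _ _ _ _ _] _ _] := hT; move=> /g[]. Qed.

Lemma sq_cols x y : theta (x, y) -> T x y x y.
Proof. by have [[_ g _ _ _ _ _] _ _] := hT; move=> /g[]. Qed.

Lemma corner_theta x y : corner (x, y) -> theta (x, y).
Proof. by have [[_ _ _ _ _ _ r] _ _] := hT; move=> /r[]. Qed.

(** Pasting degenerate squares x x / y y onto a corner square moves its equal corners to a
    [theta]-related value; symmetry and transitivity arise from such pastings. *)
Lemma corner_congruence : congruence corner.
Proof.
have [rt st _ _] := htheta; have [[cT g hs vs _ _ r] ht vt] := hT.
split=> [x|x y h|x y z h h'|f a b h]; rewrite /corner /=.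
- exact: sq_rows (rt x).
- have xy := corner_theta h.
  have h1 : T y y y x by apply: (vt _ _ x x); [exact/sq_rows/st|exact: hs].
  exact: h1.
- have xy := corner_theta h; have yz := corner_theta h'.
  apply: (vt _ _ y y); first exact: sq_rows.
  apply: (ht _ y _ y) h'.
  by apply: (vt _ _ x x) => //; apply/sq_rows/st.
- by apply: cT => k; exact: h.
Qed.

(** Stacking c c / a a, a a / a b and a b / c d gives c c / c d. *)
Lemma corner_centrality a b c d : T a b c d -> corner (a, b) -> corner (c, d).
Proof.
have [_ st _ _] := htheta; have [[_ _ _ _ _ _ r] _ vt] := hT.
move=> h hab; have [_ ac _] := r _ _ _ _ h.
by apply: (vt _ _ a a); [exact/sq_rows/st|apply: vt hab h].
Qed.

End CornerCongruence.

Section NeutralCorner.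
Variables (S : signature) (V : algebra S -> Prop) (n : nat).

(** The n-cubes all of whose two-dimensional faces lie in [T] form an n-dimensional congruence [W]
    containing Delta. By [corner_centrality] a line of such a cube is in [corner T] as soon as a
    neighbouring line is, so [corner T] is central. By neutrality it contains the meet of n copies
    of [theta]. *)
Lemma neutral_corner (A : algebra S) (theta : set (A * A)) (T : square_rel A) :
  2 <= n -> hypercommutator_neutral V n -> V A ->
  congruence theta -> sq_congruence theta T ->
  theta `<=` corner T.
Proof.
move=> n2 hN VA ht hT; have [[cT g hs vs hd vd r] htr vtr] := hT.
pose sq (gamma : cube A 'I_n) i j f := T
  (gamma (upd i false (upd j false f))) (gamma (upd i false (upd j true f)))
  (gamma (upd i true (upd j false f))) (gamma (upd i true (upd j true f))).
pose W : set (cube A 'I_n) := [set gamma | forall i j f, i != j -> sq gamma i j f].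
have hW : ncongruence W.
  split=> [f gammas h i j v ij|l].
    by apply: cT => k; exact: h.
  apply/faces_closed; split.
  - move=> gamma b h i j f ij; rewrite /sq /degenerate.
    have [->|li] := eqVneq l i.
      rewrite !upd_upd; case: b; last exact: vd (h i j f ij).
      exact: vd (vs _ _ _ _ (h i j f ij)).
    rewrite !(updC _ _ _ li); have [->|lj] := eqVneq l j.
      rewrite !upd_upd; case: b; last exact: hd (h i j f ij).
      exact: hd (hs _ _ _ _ (h i j f ij)).
    by rewrite !(updC _ _ _ lj); exact: h.
  - move=> gamma h i j f ij; rewrite /sq /flip.
    have [->|li] := eqVneq l i.
      by rewrite !upd_same !upd_upd; exact: vs (h i j f ij).
    rewrite !(updC _ _ _ li) !(ffunE, eqxx) (negbTE li).
    have [->|lj] := eqVneq l j.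
      by rewrite !upd_upd; exact: hs (h i j f ij).
    by rewrite !(updC _ _ _ lj); exact: h.
  - move=> gamma gamma' h h' /face_eqP e i j f ij; rewrite /sq /glue.
    have [li|li] := eqVneq l i.
      subst i; rewrite !upd_same.
      apply: vtr (h l j f ij) _; rewrite !e; exact: h'.
    have [lj|lj] := eqVneq l j.
      subst j; rewrite !(ffunE, eqxx) (negbTE li).
      apply: htr (h i l f ij) _; rewrite !(updC _ _ _ ij) !e -!(updC _ _ _ ij).
      exact: h'.
    by rewrite !ffunE (negbTE li) (negbTE lj); case: (f l); [exact: h'|exact: h].
have DW : Delta (fun _ : 'I_n => theta) `<=` W.
  apply: Delta_sub => // l x y xy i j f ij; rewrite /sq /cube_pair.
  have [rt _ _ _] := ht.
  have [->|li] := eqVneq l i; first by rewrite !upd_same; exact: sq_rows hT _ _ xy.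
  rewrite !(ffunE, eqxx) (negbTE li).
  have [_|lj] := eqVneq l j; first exact: sq_cols hT _ _ xy.
  by case: (f l); exact: sq_rows hT _ _ (rt _).
have <- : hypercommutator (fun _ : 'I_n => theta) = theta.
  rewrite hN //; apply/seteqP; split=> p; last by move=> h i _.
  by move=> /(_ (Ordinal (leq_trans (isT : 0 < 2) n2)) I).
move=> p; apply; split; first exact: corner_congruence ht hT.
move=> l _; apply: centralityI => gamma g0 /DW hg hg0.
have [j jl] : exists j : 'I_n, j != l.
  have : 0 < #|predC1 l| by rewrite cardC1 card_ord -ltnS prednK // (leq_trans _ n2).
  by case/card_gt0P => j; exists j.
pose f := extend g0 false.
pose g1 := restrict l (upd j (~~ f j) f).
have e1 b : extend g1 b = upd j (~~ f j) (extend g0 b).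
  by rewrite extend_restrict updC 1?eq_sym // upd_extend.
have e0 b : extend g0 b = upd j (f j) (extend g0 b).
  have -> : f j = extend g0 b j by rewrite /f !extendE.
  by rewrite upd_id.
have h1 : corner T (line gamma g1).
  apply: hg0; apply/eqP => e; have := congr1 (fun h => extend h false j) e.
  by rewrite e1 upd_same -/f; case: (f j).
have := hg j l f jl; rewrite /sq ![upd l _ f]upd_extend.
move: h1; rewrite /line !e1 (e0 false) (e0 true) !upd_upd.
case: (f j) => /= h1 hsq; first exact: (corner_centrality ht hT hsq).
by apply: (corner_centrality ht hT (vs _ _ _ _ hsq)).
Qed.

End NeutralCorner.

(** * Meet-semidistributivity and rectangles *)

(** The square is the stack of a b / a a, a a / c c and c c / c d. *)
Lemma sq_full (S : signature) (A : algebra S) (theta : set (A * A))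
    (T : square_rel A) a b c d :
  sq_congruence theta T -> theta `<=` corner T ->
  theta (a, b) -> theta (a, c) -> theta (c, d) -> T a b c d.
Proof.
move=> hT full ab ac cd; have [[_ _ _ vs _ _ _] _ vt] := hT.
apply: (vt _ _ a a); first by apply: (vs); exact: (full (a, b)).
by apply: (vt _ _ c c); [exact: sq_rows hT _ _ ac|exact: (full (c, d))].
Qed.

Section MeetSemidistributive.
Variables (S : signature) (V : algebra S -> Prop).
Hypotheses (hV : variety V) (hSD : congruence_meet_semidistributive V).

Lemma semidistributive_corner (A : algebra S) (theta : set (A * A))
    (T : square_rel A) :
  V A -> congruence theta -> sq_congruence theta T -> theta `<=` corner T.
Proof.
move=> VA ht hT [x y] hxy.
have [rt st tt ct] := ht; have [[cT g hs vs hd vd r] htr vtr] := hT.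
pose B := pair_algebra ht.
pose eta : set (B * B) := [set p | (sval p.1).1 = (sval p.2).1].
pose tau : set (B * B) := [set p |
  T (sval p.1).1 (sval p.1).2 (sval p.2).1 (sval p.2).2].
pose kappa : set (B * B) := [set p |
  T (sval p.1).1 (sval p.1).2 (sval p.1).1 (sval p.2).2].
have ceta : congruence eta.
  split=> // [u v w|f a b h]; rewrite /eta /=; first exact: etrans.
  by congr op; apply/funext.
have ctau : congruence tau.
  split; rewrite /tau /=.
  - by move=> [[a b] ab]; exact: sq_cols hT _ _ ab.
  - by move=> u v; exact: vs.
  - by move=> u v w; exact: vtr.
  - by move=> f a b h; apply: cT => k; exact: h.
have ckappa : congruence kappa.
  (* The common left entry may be replaced by any [theta]-related one, by pasting a degenerate
     square on the left. Hence [kappa] in effect compares second coordinates only. *)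
  have shift (u v : B) : kappa (u, v) ->
      T (sval v).1 (sval u).2 (sval v).1 (sval v).2.
    case: u v => [[a b] ab] [[c d] cd]; rewrite /kappa /= => h.
    apply: (htr _ _ _ _ _ _ _ h); apply: (sq_cols hT) => //; apply: (tt _ _ _ cd).
    apply: st; have [_ _ ad] := r _ _ _ _ h; exact: ad.
  split; rewrite /kappa /=.
  - by move=> [[a b] ab]; exact: sq_cols hT _ _ ab.
  - by move=> u v /shift; exact: vs.
  - move=> [[a b] ab] [[c d] cd] [[e f] ef] h h'; rewrite /= in h h' *.
    have h1 : T a d a f.
      apply: (htr _ _ _ _ _ _ _ h'); apply: (sq_cols hT); have [_ _ ad] := r _ _ _ _ h.
      by apply: (tt _ _ _ ad); exact: st.
    exact: vtr h h1.
  - by move=> f a b h; apply: cT => k; exact: h.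
have e : eta `&` tau = eta `&` kappa.
  by apply/seteqP; split=> -[[[a b] ab] [[c d] cd]]; rewrite /eta /tau /kappa /= => -[-> h].
have := hSD (pair_algebra_variety ht hV VA) ctau ckappa ceta e.
(* The path (x,x) [tau] (y,y) [kappa] (x,y) has [eta]-related ends, so they are [tau]-related, which
   is the square x x / x y. *)
pose p := exist _ (x, x) (rt x) : B; pose q := exist _ (x, y) hxy : B.
move=> /seteqP[+ _] => /(_ (p, q)) []//; split=> // M [[_ _ tM _] sM].
apply: (tM _ (exist _ (y, y) (rt y) : B)); apply: sM; [left|right].
  exact: sq_rows hT _ _ hxy.
exact: sq_rows hT _ _ (rt y).
Qed.

Definition cube_tail n (f : {ffun 'I_n.+1 -> bool}) : {ffun 'I_n -> bool} :=
  [ffun k => f (lift ord0 k)].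

Lemma cube_tail_upd n (i : 'I_n) b f :
  cube_tail (upd (lift ord0 i) b f) = upd i b (cube_tail f).
Proof. by apply/ffunP => k; rewrite !ffunE (inj_eq lift_inj). Qed.

Lemma rect_sub_ncongruence n (A : algebra S) (theta : set (A * A))
    (R : set (cube A 'I_n.+1)) :
  V A -> congruence theta -> ncongruence R ->
  (forall i x y, theta (x, y) -> R (cube_pair i x y)) ->
  rect (fun _ => theta) `<=` R.
Proof.
elim: n A theta R => [|n IH] A theta R VA ht [cR fR] gR gamma /rectP hg.
  have -> : gamma = cube_pair ord0 (gamma [ffun=> false]) (gamma [ffun=> true]).
    apply/funext => f; rewrite /cube_pair.
    have -> : f = [ffun=> f ord0] by apply/ffunP => k; rewrite ffunE (ord1 k).
    by rewrite ffunE; case: (f ord0).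
  apply: gR; have := hg ord0 [ffun=> false].
  by congr (theta (gamma _, gamma _)); apply/ffunP => k; rewrite !ffunE (ord1 k).
have [rt st tt ct] := ht.
(* Squares spread over directions 0 and [lift ord0 i], constant in all others; this slice of [R] is
   a two-dimensional congruence. *)
pose T i a b c d :=
  R (fun f => if f ord0 then (if f (lift ord0 i) then d else b)
              else (if f (lift ord0 i) then c else a))
  /\ [/\ theta (a, b), theta (a, c) & theta (a, d)].
have degR i b gamma' : R gamma' -> R (degenerate i b gamma').
  by have [d _ _] := (faces_closed _ _).1 (fR i); exact: d.
have flipR i gamma' : R gamma' -> R (flip i gamma').
  by have [_ d _] := (faces_closed _ _).1 (fR i); exact: d.
have glueR i gamma1 gamma2 : R gamma1 -> R gamma2 ->
    (forall f, gamma1 (upd i true f) = gamma2 (upd i false f)) ->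
    R (glue i gamma1 gamma2).
  move=> h1 h2 /face_eqP h3.
  by have [_ _ d] := (faces_closed _ _).1 (fR i); exact: d.
have eqR gamma1 gamma2 : R gamma1 -> (forall f, gamma1 f = gamma2 f) -> R gamma2.
  by move=> + /funext => /[swap] ->.
have n0 (i : 'I_n.+1) : (lift ord0 i == ord0) = false by [].
have n1 (i : 'I_n.+1) : (ord0 == lift ord0 i) = false by [].
have hT i : sq_congruence theta (T i).
  split; last 2 first.
  - move=> a b c d e f [h1 [ab ac ad]] [h2 [be bd bf]]; split; last first.
      by split=> //; [exact: tt ab be|exact: tt ab bf].
    apply: (eqR _ _ (glueR ord0 _ _ h1 h2 _)) => v.
      by rewrite !upd_same !ffunE !n0.
    by rewrite /glue; case: (v ord0).
  - move=> a b c d e f [h1 [ab ac ad]] [h2 [cd ce cf]]; split; last first.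
      by split=> //; [exact: tt ac ce|exact: tt ac cf].
    apply: (eqR _ _ (glueR (lift ord0 i) _ _ h1 h2 _)) => v.
      by rewrite !upd_same !ffunE !n1.
    by rewrite /glue; case: (v (lift _ _)); case: (v ord0).
  split.
  - move=> f a b c d h; split; last first.
      by split; apply: ct => k; have [_ []] := h k.
    apply: (eqR _ _ (cR f _ (fun k => (h k).1))) => v /=.
    by case: (v ord0); case: (v (lift _ _)).
  - move=> x y xy; split; split=> //.
      apply: (eqR _ _ (gR (lift ord0 i) _ _ xy)) => v.
      by rewrite /cube_pair; case: (v ord0).
    apply: (eqR _ _ (gR ord0 _ _ xy)) => v.
    by rewrite /cube_pair; case: (v (lift _ _)).
  - move=> a b c d [h [ab ac ad]]; split; last first.
      have ba := st _ _ ab; split=> //; [exact: tt ba ad|exact: tt ba ac].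
    apply: (eqR _ _ (flipR ord0 _ h)) => v.
    by rewrite /flip upd_same ffunE n0; case: (v ord0); case: (v (lift _ _)).
  - move=> a b c d [h [ab ac ad]]; split; last first.
      have ca := st _ _ ac; split=> //; [exact: tt ca ad|exact: tt ca ab].
    apply: (eqR _ _ (flipR (lift ord0 i) _ h)) => v.
    by rewrite /flip upd_same ffunE n1; case: (v ord0); case: (v (lift _ _)).
  - move=> a b c d [h [ab ac ad]]; split=> //.
    apply: (eqR _ _ (degR ord0 false _ h)) => v.
    by rewrite /degenerate upd_same ffunE n0; case: (v ord0).
  - move=> a b c d [h [ab ac ad]]; split=> //.
    apply: (eqR _ _ (degR (lift ord0 i) false _ h)) => v.
    by rewrite /degenerate upd_same ffunE n1; case: (v (lift _ _)).
  - by move=> a b c d [].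
pose B := pair_algebra ht.
pose theta2 : set (B * B) := [set p |
  theta ((sval p.1).1, (sval p.2).1) /\ theta ((sval p.1).2, (sval p.2).2)].
have ctheta2 : congruence theta2.
  split=> [u|u v [h1 h2]|u v w [h1 h2] [h3 h4]|f a b h]; rewrite /theta2 /=.
  - by split.
  - by split; exact: st.
  - by split; [exact: tt h1 h3|exact: tt h2 h4].
  - by split; apply: ct => k; have [] := h k.
pose lower (g : cube B 'I_n.+1) : cube A 'I_n.+2 := fun f =>
  let p := sval (g (cube_tail f)) in if f ord0 then p.2 else p.1.
pose cons b (h : {ffun 'I_n.+1 -> bool}) : {ffun 'I_n.+2 -> bool} :=
  [ffun k => if unlift ord0 k is Some j then h j else b].
have cons_tail (f : {ffun 'I_n.+2 -> bool}) : cons (f ord0) (cube_tail f) = f.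
  by apply/ffunP => k; rewrite ffunE; case: unliftP => [j|] ->; rewrite ?ffunE.
have cons_upd b i c h : cons b (upd i c h) = upd (lift ord0 i) c (cons b h).
  apply/ffunP => k; rewrite !ffunE; case: unliftP => [j|] -> //.
  by rewrite !ffunE (inj_eq lift_inj).
have theta_gamma h : theta (gamma (cons false h), gamma (cons true h)).
  have := hg ord0 (cons false h); congr (theta (gamma _, gamma _));
  by apply/ffunP => k; rewrite !ffunE; case: unliftP => [j|] ->.
pose gamma2 : cube B 'I_n.+1 := fun h => exist _ _ (theta_gamma h).
suff : R (lower gamma2).
  by move=> h; apply: (eqR _ _ h) => f; rewrite /lower /= -[in RHS](cons_tail f); case: (f ord0).
apply: (IH B theta2 [set g | R (lower g)]) => //.
- exact: pair_algebra_variety.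
- split=> [f g h|i].
    by apply: (eqR _ _ (cR f (fun k => lower (g k)) h)) => v; rewrite /lower /=; case: (v ord0).
  apply/faces_closed; split.
  + move=> g b /(degR (lift ord0 i) b)/eqR; apply => f.
    by rewrite /lower /degenerate cube_tail_upd ffunE n1.
  + move=> g /(flipR (lift ord0 i))/eqR; apply => f.
    by rewrite /lower /flip cube_tail_upd [upd _ _ _ ord0]ffunE n1 [cube_tail f i]ffunE.
  + move=> g g' h h' /face_eqP e; apply: (eqR _ _ (glueR (lift ord0 i) _ _ h h' _)) => f.
      by rewrite /lower !cube_tail_upd e !ffunE n1.
    by rewrite /lower /glue [cube_tail f i]ffunE; case: (f (lift _ _)).
(* A cube of [theta2] in direction [i] unfolds to a square in directions 0 and [lift ord0 i] with
   edges in [theta], and [sq_full] puts all of these into [T i]. *)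
- move=> i [[a b] ab] [[c d] cd] [/= ac bd].
  have [h _] := sq_full (hT i) (semidistributive_corner VA ht (hT i)) ab ac cd.
  apply: (eqR _ _ h) => f; rewrite /lower /cube_pair [cube_tail f i]ffunE.
  by case: (f ord0); case: (f (lift _ _)).
- apply/rectP => i h; split; rewrite /= !cons_upd; exact: hg.
Qed.

Lemma semidistributive_Delta n : 1 <= n -> Delta_eq_rect V n.
Proof.
case: n => // n _ A VA theta ht; apply/seteqP; split.
  exact: Delta_sub_rect.
move=> gamma hg M [cM sM]; apply: (rect_sub_ncongruence VA ht) hg => // i x y xy.
by apply: sM; exists i => //; exists (x, y).
Qed.

End MeetSemidistributive.

(** * Taylor terms and the fourth corner *)

Section Taylor.
Variables (S : signature) (V : algebra S -> Prop).

Definition select (A : Type) (s : nat -> bool) (a b : A) : nat -> A :=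
  fun k => if s k then a else b.

Definition idempotent_term (f : term S) :=
  forall A, V A -> forall a : A, eval (fun _ => a) f = a.

(** A Taylor identity at [i]: that position carries the first letter on the left-hand side and the
    second on the right-hand side. At a variable that does not occur it holds trivially. *)
Definition taylor_at (f : term S) (i : nat) := exists s t : nat -> bool,
  [/\ s i, ~~ t i & forall A, V A -> forall a b : A,
    eval (select s a b) f = eval (select t a b) f].

Definition taylor_term (f : term S) :=
  idempotent_term f /\ forall i, i < var_bound f -> taylor_at f i.

Variables (f : term S) (hf : taylor_term f).
Variables (A : algebra S) (VA : V A) (theta delta : set (A * A)).
Hypotheses (htheta : congruence theta) (hdelta : congruence delta).
Hypothesis delta_theta : delta `<=` theta.

Let thetaxx := let: And4 h _ _ _ := htheta in h.
Let thetaC := let: And4 _ h _ _ := htheta in h.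
Let thetaT := let: And4 _ _ h _ := htheta in h.
Let deltaxx := let: And4 h _ _ _ := hdelta in h.
Let deltaC := let: And4 _ h _ _ := hdelta in h.
Let deltaT := let: And4 _ _ h _ := hdelta in h.

Definition row_central (Q : square_rel A) :=
  forall a b c d, Q a b c d -> delta (a, b) -> delta (c, d).

(** This strengthening of row centrality is stable under transposition and, given a Taylor term,
    under composition. *)
Definition corner_determined (Q : square_rel A) :=
  forall p q p' q' p1 q1 p1' q1', Q p q p' q' -> Q p1 q1 p1' q1' ->
    delta (p, p1) -> delta (q, q1) -> delta (p', p1') -> delta (q', q1').

Lemma corner_determined_row_central Q :
  sq_pre theta theta Q -> corner_determined Q -> row_central Q.
Proof.
move=> [_ _ _ _ hd _ _] u a b c d h ab.
by apply: (u _ _ _ _ _ _ _ _ (hd _ _ _ _ h) h).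
Qed.

Lemma corner_determined_transpose Q :
  corner_determined Q -> corner_determined (transpose Q).
Proof. by move=> u p q p' q' p1 q1 p1' q1' h h1 dp dq dp'; apply: u h h1 _ _ _. Qed.

Definition insert (i : nat) (a : A) (w : nat -> A) : nat -> A :=
  fun k => if k == i then a else w k.

(* By row centrality the context [w] is irrelevant, so [a] can be replaced by
   [b] in all the variables of the idempotent term [f], one after another. *)
Lemma taylor_cancel Q a b :
  sq_pre theta theta Q -> row_central Q -> theta (a, b) ->
  (forall i, taylor_at f i -> exists2 w, (forall k, theta (a, w k)) &
    delta (eval (insert i a w) f, eval (insert i b w) f)) ->
  delta (a, b).
Proof.
move=> [cQ g _ _ _ _ _] rcQ ab h; have [idf hfi] := hf.
pose w m k := if k < m then b else a.
have hw m : m <= var_bound f -> delta (a, eval (w m) f).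
  elim: m => [_|m IH mf]; first by rewrite -{1}(idf _ VA a); exact: deltaxx.
  apply: deltaT (IH (ltnW mf)) _; have [c ac dc] := h m (hfi m mf).
  have -> : w m = insert m a (w m).
    by apply/funext => k; rewrite /insert /w; case: eqP => // ->; rewrite ltnn.
  have -> : w m.+1 = insert m b (w m).
    by apply/funext => k; rewrite /insert /w ltnS leq_eqVlt; case: eqP.
  apply: rcQ dc; apply: sq_eval => // k; rewrite /insert; case: eqP => _.
    by have [] := g _ _ ab.
  suff /g[] : theta (c k, w m k) by [].
  by apply: thetaT (thetaC (ac k)) _; rewrite /w; case: ifP.
apply: deltaT (hw _ (leqnn _)) _; rewrite -[X in (_, X)](idf _ VA).
rewrite (@eval_var_bound _ _ (w _) (fun _ => b)) => [|k kf]; first exact: deltaxx.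
by rewrite /w kf.
Qed.

(** The Taylor identity at [i] equates the values of [f] on the top letters [p], [q] arranged by [t]
    and by [s]. Putting [p1], respectively [q1], at [i] changes them only modulo [delta]. Row
    centrality transfers this to the primed letters, and a second use of the identity there allows
    [q'] at [i] to be exchanged for [q1']. *)
Lemma taylor_corner_determined Q :
  sq_pre theta theta Q -> row_central Q -> corner_determined Q.
Proof.
move=> pQ rcQ p q p' q' p1 q1 p1' q1' h h1 dp dq dp'.
have [cQ _ hs _ hd _ r] := pQ.
have [_ pp' pq'] := r _ _ _ _ h; have [_ p1p1' p1q1'] := r _ _ _ _ h1.
have q'q1' : theta (q', q1').
  by apply: thetaT (thetaC pq') _; apply: thetaT (delta_theta dp) _.
apply: (taylor_cancel pQ rcQ q'q1') => i [s [t [si ti est]]].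
exists (select s q' p').
  by move=> k; rewrite /select; case: ifP => // _; apply: thetaT (thetaC pq') _.
pose ins x y u b : nat -> A := insert i x (select u y b).
have dt u x a b : delta (if u i then a else b, x) ->
    delta (eval (select u a b) f, eval (ins x a u b) f).
  move=> dx; apply: congruence_eval => // k.
  by rewrite /ins /insert; case: eqP => [->//|_]; exact: deltaxx.
have top : delta (eval (ins p1 q t p) f, eval (ins q1 q s p) f).
  apply: deltaT (deltaC (dt t p1 q p _)) _; first by rewrite (negbTE ti).
  by rewrite -est //; apply: dt; rewrite si.
have bottom : delta (eval (ins p1' q' t p') f, eval (ins q1' q' s p') f).
  apply: rcQ top; apply: sq_eval => // k; rewrite /ins /insert /select.
  case: eqP => // _; case: (t k); case: (s k) => //; last exact: hd h.
    exact: hd (hs _ _ _ _ h).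
  exact: hs.
apply: deltaT (deltaC (dt s q' q' p' _)) _; first by rewrite si; exact: deltaxx.
rewrite est //; apply: deltaT bottom.
by apply: dt; rewrite (negbTE ti).
Qed.

(** The middle columns r / r' and s / s' need not agree modulo [delta], but the Taylor identity
    makes [f] take equal values on them when arranged by [a] and by [b]. These values form the left
    columns of two squares in [Q], whose right columns carry [q] and [q1] at [i]. Corner
    determination of [Q] then applies. *)
Lemma taylor_corner_determined_hcomp Q :
  sq_pre theta theta Q -> corner_determined Q -> corner_determined (hcomp Q).
Proof.
move=> pQ u p q p' q' p1 q1 p1' q1' [r [r' [h1 h2]]] [s [s' [h3 h4]]] dp dq dp'.
have rcQ := corner_determined_row_central pQ u.
have [cQ _ hs _ _ _ rect] := pQ.
have [pr pp' pr'] := rect _ _ _ _ h1; have [rq rr' rq'] := rect _ _ _ _ h2.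
have [p1s p1p1' p1s'] := rect _ _ _ _ h3; have [sq1 ss' sq1'] := rect _ _ _ _ h4.
have p'q' : theta (p', q') by apply: thetaT (thetaC pp') (thetaT pr rq').
have p1q1' : theta (p1, q1') by exact: thetaT p1s sq1'.
have q'q1' : theta (q', q1').
  apply: thetaT (thetaC p'q') _; apply: thetaT (thetaC pp') _.
  by apply: thetaT (delta_theta dp) _.
apply: (taylor_cancel pQ rcQ q'q1') => i [a [b [ai bi eab]]].
exists (fun _ => p'); first by move=> k; exact: thetaC.
have dt v x y z : delta (y, z) ->
    delta (eval (insert i x (fun _ => y)) f, eval (insert i x (select v y z)) f).
  move=> yz; apply: congruence_eval => // k; rewrite /insert /select.
  by case: eqP => _; [exact: deltaxx|case: ifP].
apply: deltaT (dt a q' p' p1' dp') _; apply: deltaC.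
apply: deltaT (dt b q1' p' p1' dp') _; apply: deltaC.
apply: (u (eval (select a r s) f) (eval (insert i q (select a p p1)) f)
          (eval (select a r' s') f) _
          (eval (select b r s) f) (eval (insert i q1 (select b p p1)) f)
          (eval (select b r' s') f)).
- apply: sq_eval => // k; rewrite /insert /select.
  case: eqP => [->|_]; first by rewrite ai.
  by case: ifP => _; exact: hs.
- apply: sq_eval => // k; rewrite /insert /select.
  case: eqP => [->|_]; first by rewrite (negbTE bi).
  by case: ifP => _; exact: hs.
- by rewrite eab //; exact: deltaxx.
- apply: congruence_eval => // k; rewrite /insert /select; case: eqP => // _.
  case: (a k); case: (b k); by [exact: deltaxx|exact: dp|exact: deltaC].
- by rewrite eab //; exact: deltaxx.
Qed.

End Taylor.

(** * The term condition, from two congruences to their join *)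

Section TermCondition.
Variables (S : signature) (A : algebra S) (alpha beta gamma : set (A * A)).
Hypotheses (calpha : congruence alpha) (cbeta : congruence beta).
Hypothesis cgamma : congruence gamma.
Hypothesis meet_eq : gamma `&` alpha = gamma `&` beta.

Let delta := gamma `&` alpha.

Definition lift_rows (rho : set (A * A)) : square_rel A := fun a b c d =>
  [/\ gamma (a, b), gamma (c, d), rho (a, c) & rho (b, d)].

Definition vcomp (P Q : square_rel A) : square_rel A := fun a b c d =>
  exists u v, P a b u v /\ Q u v c d.

Record row_tolerance (Q : square_rel A) : Prop := RowTolerance {
  row_compat : sq_compatible Q;
  row_refl : forall a b, gamma (a, b) -> Q a b a b;
  row_sym : forall a b c d, Q a b c d -> Q c d a b;
  row_gamma : forall a b c d, Q a b c d -> gamma (a, b) /\ gamma (c, d);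
  row_cent : row_central delta Q
}.

Lemma lift_rows_central rho : congruence rho -> gamma `&` rho = delta ->
  row_central delta (lift_rows rho).
Proof.
move=> [_ s t _] <- a b c d [ab cd ac bd] [_ rab]; split=> //.
by apply: (t _ _ _ (s _ _ ac)); apply: t rab bd.
Qed.

Lemma row_tolerance_lift rho : congruence rho -> gamma `&` rho = delta ->
  row_tolerance (lift_rows rho).
Proof.
move=> crho e; have [r s t c] := crho; have [_ _ _ cg] := cgamma; split.
- move=> f a b c' d h; split; [apply: cg|apply: cg|apply: c|apply: c] => k;
  by have [] := h k.
- by move=> a b ab; split.
- by move=> a b c' d [? ? ? ?]; split=> //; apply: s.
- by move=> a b c' d [].
- exact: lift_rows_central.
Qed.

Lemma row_tolerance_sandwich P Q : row_tolerance P -> row_tolerance Q ->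
  row_tolerance (vcomp P (vcomp Q P)).
Proof.
move=> [cP rP sP gP eP] [cQ rQ sQ gQ eQ].
have cv P1 P2 : sq_compatible P1 -> sq_compatible P2 -> sq_compatible (vcomp P1 P2).
  move=> c1 c2 f a b c d /choice[u /choice[v h]].
  by exists (op u), (op v); split; [apply: c1|apply: c2] => k; have [] := h k.
split.
- by apply: (cv) => //; exact: cv.
- move=> a b ab; exists a, b; split; first exact: rP.
  by exists a, b; split; [exact: rQ|exact: rP].
- move=> a b c d [u [v [h1 [u' [v' [h2 h3]]]]]].
  exists u', v'; split; first exact: sP.
  by exists u, v; split; [exact: sQ|exact: sP].
- move=> a b c d [u [v [/gP[ab _] [u' [v' [_ /gP[_ cd]]]]]]].
  by split.
- move=> a b c d [u [v [/eP h1 [u' [v' [/eQ h2 /eP h3]]]]]].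
  by move=> /h1/h2/h3.
Qed.

(* Composing three copies, rather than appending one, keeps every stage
   symmetric. *)
Fixpoint row_chain k : square_rel A :=
  if k is k'.+1 then vcomp (row_chain k') (vcomp (row_chain k') (row_chain k'))
  else vcomp (lift_rows alpha) (vcomp (lift_rows beta) (lift_rows alpha)).

Lemma row_chain_tolerance k : row_tolerance (row_chain k).
Proof.
elim: k => [|k IH] /=; apply: row_tolerance_sandwich => //;
  by apply: row_tolerance_lift => //; rewrite -meet_eq.
Qed.

Lemma row_chain_mono j k a b c d : j <= k ->
  row_chain j a b c d -> row_chain k a b c d.
Proof.
move=> /subnK <-; elim: (k - j) => [//|i IH] /IH h /=.
have [_ r _ g _] := row_chain_tolerance (i + j); have [_ /r h'] := g _ _ _ _ h.
by exists c, d; split=> //; exists c, d.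
Qed.

(* The congruence generated by alpha and beta on the algebra gamma. *)
Definition row_join : square_rel A := fun a b c d => exists k, row_chain k a b c d.

Lemma row_join_compatible : sq_compatible row_join.
Proof.
apply: sq_compatible_union => [k|k a b c d].
  by have [] := row_chain_tolerance k.
exact/row_chain_mono/leqnSn.
Qed.

(** The diagonal part of [row_join] is a congruence containing [alpha] and [beta]. *)
Lemma row_join_cjoin x y : cjoin alpha beta (x, y) -> row_join x x y y.
Proof.
have [ra _ _ _] := calpha; have [rb _ _ _] := cbeta; have [rg _ _ _] := cgamma.
pose rho : set (A * A) := [set p | row_join p.1 p.1 p.2 p.2].
move=> /(_ rho); apply; split.
  split; rewrite /rho /=.
  - by move=> u; exists 0; have [_ r _ _ _] := row_chain_tolerance 0; exact: r.
  - move=> u v [k h]; exists k; have [_ _ s _ _] := row_chain_tolerance k.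
    exact: s.
  - move=> u v w [j h] [k h']; exists (maxn j k).+1 => /=.
    exists v, v; split; first by apply: row_chain_mono h; exact: leq_maxl.
    exists w, w; split; first by apply: row_chain_mono h'; exact: leq_maxr.
    by have [_ r _ _ _] := row_chain_tolerance (maxn j k); exact: r.
  - by move=> f a b h; apply: row_join_compatible.
move=> [u v] [h|h]; exists 0.
  exists v, v; split; first by split.
  by exists v, v; split; split.
exists u, u; split; first by split.
by exists v, v; split; split.
Qed.

Lemma row_join_central : row_central delta row_join.
Proof.
by move=> a b c d [k]; have [_ _ _ _ e] := row_chain_tolerance k; exact: e.
Qed.

(** The matrices of the term condition in commutator theory: the subalgebra of fourth powers
    generated by the cubes of [theta]. *)
Definition matrices (theta : set (A * A)) : square_rel A := fun a b c d =>
  forall Q, sq_compatible Q ->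
    (forall x y, theta (x, y) -> Q x x y y /\ Q x y x y) -> Q a b c d.

Lemma sq_pre_matrices theta : congruence theta ->
  sq_pre theta theta (matrices theta).
Proof.
move=> [r s t c].
have cM : sq_compatible (matrices theta).
  by move=> f a b c' d h Q cQ gQ; apply: (cQ) => k; exact: h.
have gM x y : theta (x, y) -> matrices theta x x y y /\ matrices theta x y x y.
  by move=> xy; split=> Q _ /(_ _ _ xy)[].
have rectM a b c' d : matrices theta a b c' d ->
    [/\ theta (a, b), theta (a, c') & theta (a, d)].
  move=> /(_ (fun a b c d => [/\ theta (a, b), theta (a, c) & theta (a, d)])).
  apply=> [f a' b' c'' d' h|x y xy]; last by split; split.
  by split; apply: c => k; have [] := h k.
split=> //.
- move=> a b c' d /(_ (fun a b c d => matrices theta b a d c)).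
  apply=> [f a' b' c'' d' h|x y xy]; first exact: cM.
  by split; [exact: (gM x y xy).1|exact: (gM y x (s _ _ xy)).2].
- move=> a b c' d /(_ (fun a b c d => matrices theta c d a b)).
  apply=> [f a' b' c'' d' h|x y xy]; first exact: cM.
  by split; [exact: (gM y x (s _ _ xy)).1|exact: (gM x y xy).2].
- by move=> a b c' d /rectM[_ /gM[]].
- by move=> a b c' d /rectM[/gM[]].
Qed.

(** Every generator lies in [row_join]: x x / y y because of the join, x y / x y because of
    [gamma]. *)
Lemma matrices_row_central :
  row_central delta (matrices (gamma `&` cjoin alpha beta)).
Proof.
move=> a b c d /(_ row_join row_join_compatible) h; apply: row_join_central.
apply: h => x y [gxy jxy]; split; first exact: row_join_cjoin.
by exists 0; have [_ r _ _ _] := row_chain_tolerance 0; exact: r.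
Qed.

End TermCondition.

Lemma taylor_semidistributive (S : signature) (V : algebra S -> Prop) n f :
  2 <= n -> hypercommutator_neutral V n -> taylor_term V f ->
  congruence_meet_semidistributive V.
Proof.
move=> n2 hN hf A VA alpha beta gamma ca cb cg e; apply/seteqP; split; last first.
  by move=> p [h h']; split=> // M [_ sM]; apply: sM; left.
set theta := _ `&` cjoin _ _; set delta := _ `&` _.
have ct : congruence theta by apply: congruenceI => //; exact: smallest_congruence.
have cd : congruence delta by exact: congruenceI.
have dt : delta `<=` theta.
  by move=> p [h h']; split=> // M [_ sM]; apply: sM; left.
have [rt _ _ _] := ct; have [rd _ _ _] := cd.
have pM := sq_pre_matrices ct.
have uM := taylor_corner_determined hf VA ct cd dt pM (matrices_row_central ca cb cg e).
have [T hT] := sq_closure ct (@subset_refl _ theta) (fun _ _ => id) rt pM uM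
  (taylor_corner_determined_hcomp hf VA ct cd dt)
  (@corner_determined_transpose _ _ delta).
move=> hTQ [x y] /(neutral_corner n2 hN VA ct hT) /hTQ[Q [[_ g _ _ _ _ _] uQ] hQ].
(* The squares x x / x x and x x / x y agree in three corners, so [x] and [y] agree modulo
   [delta]. *)
have [hx _] := g _ _ (rt x).
exact: uQ hx hQ (rd _) (rd _) (rd _).
Qed.

(** * The free algebra on two generators *)

Section FreeAlgebra.
Variables (S : signature) (V : algebra S -> Prop) (hV : variety V).

Definition term_algebra : algebra S :=
  @Algebra S (term S) (inhabits (Var S 0)) (@App S).

(* Evaluation in [term_algebra] is substitution. *)
Lemma eval_term_algebra (A : algebra S) (v : nat -> A) (s : nat -> term_algebra) t :
  eval v (eval s t : term S) = eval (fun k => eval v (s k)) t.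
Proof. exact: (@eval_hom S term_algebra A (eval v)). Qed.

(** Terms have infinitely many variables; variable 0 is read as the first generator and all others
    as the second. *)
Definition free_rel : set (term_algebra * term_algebra) :=
  [set p | forall A, V A -> forall a b : A,
    eval (select (eq_op^~ 0) a b) p.1 = eval (select (eq_op^~ 0) a b) p.2].

Lemma free_rel_congruence : congruence free_rel.
Proof.
split.
- by [].
- by move=> s t h A VA a b; rewrite h.
- by move=> s t u h h' A VA a b; rewrite h // h'.
- move=> f s t h A VA a b /=; congr op; apply/funext => k.
  exact: (h k A VA a b).
Qed.

Definition free_algebra : algebra S := quotient free_rel.

Let cls : term_algebra -> free_algebra := @class_of S term_algebra free_rel.

Definition free_x : free_algebra := cls (Var S 0).
Definition free_y : free_algebra := cls (Var S 1).

Lemma eval_cls (s : nat -> term_algebra) t :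
  eval (cls \o s) t = cls (eval s t).
Proof.
rewrite (@eval_hom S term_algebra free_algebra cls) // => f a.
exact/esym/(quotient_op free_rel_congruence).
Qed.

Lemma free_algebra_variety : V free_algebra.
Proof.
have [E hE] := hV; apply/hE => e Ee v.
have -> : v = cls \o (fun k => class_repr (v k)).
  by apply/funext => k /=; rewrite /cls class_reprK.
rewrite !eval_cls; apply/(eq_class_of free_rel_congruence) => A VA a b /=.
by rewrite !eval_term_algebra; have /hE/(_ e Ee) := VA; apply.
Qed.

Lemma select_free (s : nat -> bool) :
  select s free_x free_y = cls \o select s (Var S 0) (Var S 1).
Proof. by apply/funext => k; rewrite /select /=; case: (s k). Qed.

Lemma free_identity h h' (s t : nat -> bool) :
  eval (select s free_x free_y) h = eval (select t free_x free_y) h' ->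
  forall A, V A -> forall a b : A, eval (select s a b) h = eval (select t a b) h'.
Proof.
rewrite !select_free !eval_cls => /(eq_class_of free_rel_congruence) e A VA a b.
have := e A VA a b; rewrite /= !eval_term_algebra.
have sub (u : nat -> bool) : (fun k => eval (select (eq_op^~ 0) a b)
    (select u (Var S 0) (Var S 1) k)) = select u a b.
  by apply/funext => k; rewrite /select; case: (u k).
by rewrite !sub.
Qed.

Lemma free_idempotent h :
  eval (fun _ => free_x) h = free_x -> idempotent_term V h.
Proof.
move=> e A VA a.
exact: (@free_identity h (Var S 0) (fun _ => true) (fun _ => true) e A VA a a).
Qed.

Lemma free_generated (u : free_algebra) :
  exists t, u = eval (select (eq_op^~ 0) free_x free_y) t.
Proof.
exists (class_repr u); rewrite select_free eval_cls -{1}(class_reprK u).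
apply/(eq_class_of free_rel_congruence) => A VA a b /=.
rewrite eval_term_algebra; congr eval; apply/funext => k.
by rewrite /select; case: eqP.
Qed.

(* The endomorphism sending both generators to [free_x]. *)
Definition free_collapse (u : free_algebra) : free_algebra :=
  eval (fun _ => free_x) (class_repr u).

Lemma free_collapse_cls t : free_collapse (cls t) = eval (fun _ => free_x) t.
Proof.
have : cls (class_repr (cls t)) = cls t by exact: class_reprK.
move=> /(eq_class_of free_rel_congruence)/(_ _ free_algebra_variety free_x free_x) /=.
have -> : select (eq_op^~ 0) free_x free_x = fun _ => free_x.
  by apply/funext => k; rewrite /select if_same.
by [].
Qed.

Lemma free_collapse_op f (a : 'I_(arity f) -> free_algebra) :
  free_collapse (op a) = op (free_collapse \o a).
Proof. exact: free_collapse_cls. Qed.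

Definition free_theta : set (free_algebra * free_algebra) :=
  smallest (@congruence S free_algebra) [set (free_x, free_y)].

(** [free_theta] lies in the kernel of the collapse, which sends any value of [h] at generators to
    h(x,...,x) and fixes [free_x]. *)
Lemma free_theta_idempotent h (s : nat -> bool) :
  free_theta (free_x, eval (select s free_x free_y) h) -> idempotent_term V h.
Proof.
pose kappa : set (free_algebra * free_algebra) :=
  [set p | free_collapse p.1 = free_collapse p.2].
have fx : free_collapse free_x = free_x by exact: free_collapse_cls.
have fy : free_collapse free_y = free_x by exact: free_collapse_cls.
have ckappa : congruence kappa.
  split=> // [u v w|f a b e]; first exact: etrans.
  change (free_collapse (op a) = free_collapse (op b)).
  rewrite !free_collapse_op.
  by congr op; apply/funext => k; exact: e.
have gkappa : [set (free_x, free_y)] `<=` kappa.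
  by move=> _ ->; rewrite /kappa /= fx fy.
move=> /(_ kappa (conj ckappa gkappa)).
rewrite /kappa /= fx (eval_hom _ _ free_collapse_op) => e; apply: free_idempotent.
rewrite [RHS]e; congr eval; apply/funext => k /=.
by rewrite /select; case: (s k).
Qed.

Definition non_taylor_at (h : term S) (i : nat) :=
  forall s t, eval (select s free_x free_y) h = eval (select t free_x free_y) h ->
    s i = t i.

Lemma non_taylorP h : idempotent_term V h -> ~ taylor_term V h ->
  exists i, non_taylor_at h i.
Proof.
move=> idh nth; apply: contrapT => nh; apply: nth; split=> // i _.
apply: contrapT => ni; apply: nh; exists i => s t /free_identity e.
case si: (s i); case ti: (t i) => //; exfalso; apply: ni.
  by exists s, t; rewrite si ti.
by exists t, s; rewrite si ti; split=> // A VA a b; rewrite e.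
Qed.

(** The star composition h(h'(z00, z01, ...), h'(z10, ...), ...). For idempotent terms, identifying
    variables along rows or columns recovers [h] and [h'], so it is a common refinement of both. *)
Definition star (h h' : term S) : term S :=
  @eval S term_algebra
    (fun i => @eval S term_algebra (fun j => Var S (pickle (i, j))) h') h.

(** The default is harmless: only variables [pickle (i, j)] occur in [star]. *)
Definition unpair (k : nat) : nat * nat := odflt (0, 0) (unpickle k).

Lemma unpairK p : unpair (pickle p) = p.
Proof. by rewrite /unpair pickleK. Qed.

Lemma eval_star (A : algebra S) (v : nat -> A) h h' :
  eval v (star h h') = eval (fun i => eval (fun j => v (pickle (i, j))) h') h.
Proof.
rewrite /star eval_term_algebra; congr eval; apply/funext => i.
by rewrite eval_term_algebra.
Qed.

Lemma eval_star_fst (A : algebra S) (v : nat -> A) h h' : V A ->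
  idempotent_term V h' ->
  eval (fun k => v (unpair k).1) (star h h') = eval v h.
Proof.
move=> VA idh'; rewrite eval_star; congr eval; apply/funext => i.
rewrite -[RHS](idh' _ VA); congr eval; apply/funext => j.
by rewrite unpairK.
Qed.

Lemma eval_star_snd (A : algebra S) (v : nat -> A) h h' : V A ->
  idempotent_term V h ->
  eval (fun k => v (unpair k).2) (star h h') = eval v h'.
Proof.
move=> VA idh; rewrite eval_star -[RHS](idh _ VA); congr eval; apply/funext => i.
by congr eval; apply/funext => j; rewrite unpairK.
Qed.

Lemma star_idempotent h h' : idempotent_term V h -> idempotent_term V h' ->
  idempotent_term V (star h h').
Proof.
move=> idh idh' A VA a; rewrite (eval_star_fst (fun _ => a) h VA idh').
exact: idh.
Qed.

Definition constant_in_one_direction (a b c d : bool) :=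
  (a == b) && (c == d) || (a == c) && (b == d).

(* The coordinates at which an idempotent term violates the Taylor condition
   behave like projections: [h(s) |-> s i] is well defined there. Along these
   projections the square degenerates to one of the two-element set. *)
Definition set_like : square_rel free_algebra := fun a b c d =>
  exists h, idempotent_term V h /\ exists s1 s2 s3 s4,
   [/\ [/\ a = eval (select s1 free_x free_y) h,
           b = eval (select s2 free_x free_y) h,
           c = eval (select s3 free_x free_y) h &
           d = eval (select s4 free_x free_y) h] &
       forall i, non_taylor_at h i ->
         constant_in_one_direction (s1 i) (s2 i) (s3 i) (s4 i)].

Lemma set_like_transpose a b c d : set_like a b c d -> set_like a c b d.
Proof.
move=> [h [idh [s1 [s2 [s3 [s4 [[? ? ? ?] hs]]]]]]].
exists h; split=> //; exists s1, s3, s2, s4; split=> // i /hs.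
by rewrite /constant_in_one_direction orbC.
Qed.

(** Both squares are rewritten with [star h h']. A non-Taylor coordinate of it projects to
    non-Taylor coordinates of [h] and [h'], and there the shared column forces equal bits. What
    remains is gluing on the two-element set, a finite check. *)
Lemma set_like_glue a b c d e f :
  set_like a b c d -> set_like b e d f -> set_like a e c f.
Proof.
move=> [h [idh [s1 [s2 [s3 [s4 [[ea eb ec ed] hs]]]]]]].
move=> [h' [idh' [t1 [t2 [t3 [t4 [[eb' ee ed' ef] ht]]]]]]].
have Vf := free_algebra_variety.
have lift1 s : eval (select s free_x free_y) h =
    eval (select (fun k => s (unpair k).1) free_x free_y) (star h h').
  by rewrite -(eval_star_fst _ h Vf idh').
have lift2 s : eval (select s free_x free_y) h' =
    eval (select (fun k => s (unpair k).2) free_x free_y) (star h h').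
  by rewrite -(eval_star_snd _ h' Vf idh).
exists (star h h'); split; first exact: star_idempotent.
exists (fun k => s1 (unpair k).1), (fun k => t2 (unpair k).2),
       (fun k => s3 (unpair k).1), (fun k => t4 (unpair k).2).
split; first by rewrite -!lift1 -!lift2.
move=> m hm.
have hm1 : non_taylor_at h (unpair m).1.
  by move=> s t; rewrite !lift1 => /hm.
have hm2 : non_taylor_at h' (unpair m).2.
  by move=> s t; rewrite !lift2 => /hm.
have e1 : s2 (unpair m).1 = t1 (unpair m).2.
  by apply: (hm (fun k => s2 (unpair k).1) (fun k => t1 (unpair k).2));
     rewrite -lift1 -lift2 -eb.
have e2 : s4 (unpair m).1 = t3 (unpair m).2.
  by apply: (hm (fun k => s4 (unpair k).1) (fun k => t3 (unpair k).2));
     rewrite -lift1 -lift2 -ed.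
move: (hs _ hm1) (ht _ hm2); rewrite /constant_in_one_direction e1 e2.
by case: (s1 _); case: (t1 _); case: (s3 _); case: (t3 _); case: (t2 _); case: (t4 _).
Qed.

(* Variable [k < 6] stands for the [k]-th of the six squares over the two
   generators that are constant in some direction. *)
Definition corner1 := nth false [:: true; false; true; false; true; false].
Definition corner2 := nth false [:: true; false; true; false; false; true].
Definition corner3 := nth false [:: true; false; false; true; true; false].
Definition corner4 := nth false [:: true; false; false; true; false; true].

(** Variables from 6 on take the default [false], hence stand for the constant square y. *)
Definition free_matrices : square_rel free_algebra := fun a b c d => exists t,
  [/\ a = eval (select corner1 free_x free_y) t,
      b = eval (select corner2 free_x free_y) t,
      c = eval (select corner3 free_x free_y) t &
      d = eval (select corner4 free_x free_y) t].

Lemma free_matrices_rename (r : nat -> nat) t :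
  free_matrices (eval (select (corner1 \o r) free_x free_y) t)
                (eval (select (corner2 \o r) free_x free_y) t)
                (eval (select (corner3 \o r) free_x free_y) t)
                (eval (select (corner4 \o r) free_x free_y) t).
Proof.
exists (@eval S term_algebra (fun k => Var S (r k)) t).
by split; rewrite eval_term_algebra.
Qed.

Definition free_generators : set (free_algebra * free_algebra) :=
  [set p | p.1 = p.2 \/ p = (free_x, free_y)].

Lemma free_generators_theta : free_generators `<=` free_theta.
Proof.
move=> [u v] [/= <-|->].
  by have [r _ _ _] := smallest_congruence [set (free_x, free_y)]; exact: r.
by move=> M [_ sM]; apply: sM.
Qed.

Lemma sq_pre_free_matrices :
  sq_pre free_generators free_theta free_matrices.
Proof.
have ct := smallest_congruence [set (free_x, free_y)].
have [rt st _ _] := ct.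
have txy : free_theta (free_x, free_y) by apply: free_generators_theta; right.
(* Reflections permute the six generating squares, and degeneracies collapse two of them to constant
   ones. The default 6 sends every variable beyond the list to a constant square y. *)
have rename (r : seq nat) (c1 c2 c3 c4 : nat -> bool) t :
    let: r' := nth 6 r in
    corner1 \o r' =1 c1 -> corner2 \o r' =1 c2 -> corner3 \o r' =1 c3 ->
    corner4 \o r' =1 c4 ->
    free_matrices (eval (select c1 free_x free_y) t)
                  (eval (select c2 free_x free_y) t)
                  (eval (select c3 free_x free_y) t)
                  (eval (select c4 free_x free_y) t).
  by do 4 move=> /funext <-; exact: free_matrices_rename.
split.
- move=> f a b c d /choice[t h]; exists (App t).
  by split; apply: (congr1 (@op S free_algebra f)); apply/funext => k; have [] := h k.
- move=> u v [/= <-|[-> ->]]; last by split; [exists (Var S 2)|exists (Var S 4)].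
  have [t ->] := free_generated u.
  by split; apply: (rename [:: 0]) => -[|k] //=; rewrite nth_nil.
- move=> _ _ _ _ [t [-> -> -> ->]]; apply: (rename [:: 0; 1; 2; 3; 5; 4]);
  by do 6 (case=> //); move=> k;
  rewrite /corner1 /corner2 /corner3 /corner4 /= !nth_nil.
- move=> _ _ _ _ [t [-> -> -> ->]]; apply: (rename [:: 0; 1; 3; 2; 4; 5]);
  by do 6 (case=> //); move=> k;
  rewrite /corner1 /corner2 /corner3 /corner4 /= !nth_nil.
- move=> _ _ _ _ [t [-> _ -> _]]; apply: (rename [:: 0; 1; 2; 3; 0; 1]);
  by do 6 (case=> //); move=> k;
  rewrite /corner1 /corner2 /corner3 /corner4 /= !nth_nil.
- move=> _ _ _ _ [t [-> -> _ _]]; apply: (rename [:: 0; 1; 0; 1; 4; 5]);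
  by do 6 (case=> //); move=> k;
  rewrite /corner1 /corner2 /corner3 /corner4 /= !nth_nil.
- move=> _ _ _ _ [t [-> -> -> ->]]; split; apply: congruence_eval => // k;
  by rewrite /select; do 2 case: ifP => _ //; apply: st.
Qed.

Lemma neutral_taylor n : 2 <= n -> hypercommutator_neutral V n ->
  exists f, taylor_term V f.
Proof.
move=> n2 hN; apply: contrapT => nT.
have ct := smallest_congruence [set (free_x, free_y)].
have [rt _ tt _] := ct.
(* The condition on [a] makes the representing term idempotent, by [free_theta_idempotent]. It
   passes to the second square of a composition since edges lie in [free_theta]. *)
pose P Q := forall a b c d : free_algebra, Q a b c d ->
  free_theta (free_x, a) -> set_like a b c d.
have [|||| |T hT hTQ] := sq_closure (P := P) ct free_generators_theta _ _ sq_pre_free_matrices.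
- by move=> rho crho sG p; apply=> //; split=> // _ ->; apply: sG; right.
- by move=> a; left.
- move=> a b c d [t [ea eb ec ed]]; rewrite {1}ea => /free_theta_idempotent idt.
  exists t; split=> //; exists corner1, corner2, corner3, corner4; split=> // i _.
  by do 6 case: i => [//|i]; 
  rewrite /constant_in_one_direction /corner1 /corner2 /corner3 /corner4 /= !nth_nil.
- move=> Q [_ _ _ _ _ _ r] hQ a b c d [u [v [h1 h2]]] xa.
  apply: set_like_glue (hQ _ _ _ _ h1 xa) (hQ _ _ _ _ h2 _).
  by have [au _ _] := r _ _ _ _ h1; exact: tt xa au.
- by move=> Q hQ a b c d h xa; apply/set_like_transpose/hQ.
have txy : free_theta (free_x, free_y) by apply: free_generators_theta; right.
have /hTQ[Q [_ PQ]] := neutral_corner n2 hN free_algebra_variety ct hT txy.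
move=> /PQ/(_ (rt _))[h [idh [s1 [s2 [s3 [s4 [[e1 e2 e3 e4] hs]]]]]]].
have [i hi] : exists i, non_taylor_at h i.
  by apply: non_taylorP => // hT'; apply: nT; exists h.
have cst b : eval (select (fun _ => b) free_x free_y) h = if b then free_x else free_y.
  by case: b; exact: (idh _ free_algebra_variety).
(* At [i] the bits are determined by the corners, so x x / x y would give true, true, true, false,
   which is constant in no direction. *)
have := hs i hi.
rewrite (hi s1 (fun _ => true)) ?cst -?e1 // (hi s2 (fun _ => true)) ?cst -?e2 //.
by rewrite (hi s3 (fun _ => true)) ?cst -?e3 // (hi s4 (fun _ => false)) ?cst -?e4.
Qed.

End FreeAlgebra.

Theorem theorem5p2 (S : signature) (V : algebra S -> Prop) (hV : variety V) :
  [<-> congruence_meet_semidistributive V;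
       Delta_eq_rect V 2;
       (forall n : nat, 2 <= n -> Delta_eq_rect V n);
       (exists2 n : nat, 2 <= n & Delta_eq_rect V n);
       (exists2 n : nat, 2 <= n & hypercommutator_neutral V n);
       hypercommutator_neutral V 2].
Proof.
have neutral_sd n : 2 <= n -> hypercommutator_neutral V n ->
    congruence_meet_semidistributive V.
  by move=> n2 hN; have [f] := neutral_taylor hV n2 hN; exact: taylor_semidistributive hN.
tfae.
- by move=> hSD; exact: semidistributive_Delta.
(* The passage from dimension 2 to all dimensions goes through binary neutrality and
   meet-semidistributivity. *)
- move=> /Delta_neutral hN n n2; apply: semidistributive_Delta (ltnW n2) => //.
  exact: neutral_sd (hN _).
- by move=> h; exists 2 => //; exact: h.
- by move=> [n n2 h]; exists n => //; exact: Delta_neutral.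
- move=> [n n2 /(neutral_sd n n2) hSD].
  by apply: Delta_neutral => //; exact: semidistributive_Delta.
- exact: neutral_sd.
Qed.
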